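(* Suppose that the assumptions (A1), (A2), (A3) in the context are satisfied. Let $\alpha>0$ and $\xi\in(0,1]$. There exists $\bar h>0$ such that for every $h\ge\bar h$ the stepsizes $\alpha_k=\frac{\alpha}{(k+h)^\xi}$ satisfy the stepsize condition (S) in the context, and the iterates $\theta_{k+1}=\theta_k+\alpha_k(F(X_k,\theta_k)+w_k)$ started from $\theta_0\in\mathbb{R}^d$ satisfy the following bounds, where $K=\min\{k:k\ge t_k\}$, $\beta_1=(\|\theta_0\|+\|\theta_0-\theta^*\|+1)^2$, $\beta_2=130L^2(\|\theta^*\|+1)^2$ and $L_3=\frac{\log(C/\rho)}{\log(1/\rho)}$. (1)(a) When $\xi=1$ and $\alpha<1/c_0$, for all $k\ge K$: $$\mathbb{E}[\|\theta_k-\theta^*\|^2]\le\beta_1\left(\frac{K+h}{k+h}\right)^{c_0\alpha}+\frac{8\beta_2\alpha^2L_3}{1-c_0\alpha}\,\frac{\log\left(\frac{k+h}{\alpha}\right)+1}{(k+h)^{c_0\alpha}}.$$ (1)(b) When $\xi=1$ and $\alpha=1/c_0$, for all $k\ge K$: $$\mathbb{E}[\|\theta_k-\theta^*\|^2]\le\beta_1\left(\frac{K+h}{k+h}\right)+8\beta_2\alpha^2L_3\,\frac{\log(k+h)\left[\log\left(\frac{k+h}{\alpha}\right)+1\right]}{k+h}.$$ (1)(c) When $\xi=1$ and $\alpha>1/c_0$, for all $k\ge K$: $$\mathbb{E}[\|\theta_k-\theta^*\|^2]\le\beta_1\left(\frac{K+h}{k+h}\right)^{c_0\alpha}+\frac{8e\beta_2\alpha^2L_3}{c_0\alpha-1}\,\frac{\log\left(\frac{k+h}{\alpha}\right)+1}{k+h}.$$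 (2) When $\xi\in(0,1)$ and $\alpha>0$, assuming $K\ge[2\xi/(c_0\alpha)]^{1/(1-\xi)}$, for all $k\ge K$: $$\mathbb{E}[\|\theta_k-\theta^*\|^2]\le\beta_1e^{-\frac{c_0\alpha}{1-\xi}\left((k+h)^{1-\xi}-(K+h)^{1-\xi}\right)}+\frac{4\beta_2\alpha L_3}{c_0}\,\frac{\log\left(\frac{k+h}{\alpha}\right)+1}{(k+h)^\xi}.$$
   Context: $\|\cdot\|$ is the Euclidean norm. $\mathcal{X}\subseteq\mathbb{R}^{n_X}$, $F:\mathcal{X}\times\mathbb{R}^d\to\mathbb{R}^d$, $\{X_k\}_{k\ge0}$ is a Markov chain on $\mathcal{X}$ with transition kernel $P$ and stationary distribution $\mu_X$, and $\bar F(\theta)=\mathbb{E}_{X\sim\mu_X}[F(X,\theta)]$. The initial point $\theta_0\in\mathbb{R}^d$ is given and $\{w_k\}$ is an $\mathbb{R}^d$-valued noise sequence (possibly depending on $\{\theta_k\}$). $\mathcal{F}_k$ is the $\sigma$-algebra generated by $\{\theta_i,X_i,w_i\}_{0\le i\le k-1}\cup\{\theta_k,X_k\}$. $\|\cdot\|_{\mathrm{TV}}$ is total variation distance ($\sup_A|\mu(A)-\nu(A)|$). (A1) There is $L_1>0$ such that $\|F(x,\theta_1)-F(x,\theta_2)\|\le L_1\|\theta_1-\theta_2\|$ for all $\theta_1,\theta_2,x$, and $\|F(x,0)\|\le L_1$ for all $x$. (A2) The equation $\bar F(\theta)=0$ has a unique solution $\theta^*$, and there is $c_0>0$ such that $(\theta-\theta^*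 )^\top\bar F(\theta)\le -c_0\|\theta-\theta^*\|^2$ for all $\theta\in\mathbb{R}^d$. (A3) (1) $\{X_k\}$ is uniformly geometrically ergodic with unique stationary distribution $\mu_X$: there are $C\ge1$, $\rho\in(0,1)$ (these are the constants in $L_3$) with $\sup_{x\in\mathcal{X}}\|P^k(x,\cdot)-\mu_X(\cdot)\|_{\mathrm{TV}}\le C\rho^k$ for all $k\ge0$. (2) $\mathbb{E}[w_k\mid\mathcal{F}_k]=0$ and $\|w_k\|\le L_2(\|\theta_k\|+1)$ for all $k\ge0$, where $L_2>0$ is a constant. Notation: $L=L_1+L_2$, with the standing convention $L\ge1$. For $\delta>0$ the mixing time is $t_\delta=\min\{k\ge0:\sup_{x\in\mathcal{X}}\|P^k(x,\cdot)-\mu_X(\cdot)\|_{\mathrm{TV}}\le\delta\}$; $t_k:=t_{\alpha_k}$; $\alpha_{i,j}:=\sum_{l=i}^{j}\alpha_l$. (S) The stepsize condition: (1) $\{\alpha_k\}$ is non-increasing and $\alpha_0\in(0,1)$; (2) $\alpha_{k-t_k,k-1}<\frac{c_0}{130L^2}$ for all $k\ge t_k$. *)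

(* Defs.v *)
From HB Require Import structures.
From mathcomp Require Import all_boot all_order all_algebra.
From mathcomp Require Import all_classical all_reals all_analysis.

Set Implicit Arguments.
Unset Strict Implicit.
Unset Printing Implicit Defensive.

Import Order.TTheory GRing.Theory Num.Theory.
Import numFieldNormedType.Exports.

Local Open Scope classical_set_scope.
Local Open Scope ring_scope.

(* Matrices carry the product sigma-algebra, generated by the entries; on
   'rV[R]_n this is the Borel sigma-algebra of R^n. *)
Definition entry_sets {d} {T : measurableType d} (m n : nat) :
    set (set 'M[T]_(m, n)) :=
  \bigcup_(ij in [set: 'I_m * 'I_n])
    preimage_set_system setT (fun M : 'M[T]_(m, n) => M ij.1 ij.2) measurable.

HB.instance Definition _ d (T : measurableType d) (m n : nat) :=
  Measurable.copy 'M[T]_(m, n) (g_sigma_algebraType (@entry_sets d T m n)).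

(* The subset X of R^n as a type, with the trace sigma-algebra. The library
   asks measurable types to be inhabited; x0 is the witness and plays no other
   role. *)
Definition state_space {R : realType} {n : nat} {X : set 'rV[R]_n} (x0 : X)
  : Type := X.

Section state_space.
Context {R : realType} {n : nat} {X : set 'rV[R]_n} (x0 : X).

HB.instance Definition _ := Choice.copy (state_space x0) X.
HB.instance Definition _ := isPointed.Build (state_space x0) x0.

Definition state_val (x : state_space x0) : 'rV[R]_n := set_val x.

HB.instance Definition _ :=
  Measurable.copy (state_space x0) (g_sigma_algebra_preimageType state_val).

End state_space.

Section euclidean.
Context {R : realType} {n : nat}.
Implicit Types u v : 'rV[R]_n.

Definition dot u v : R := \sum_(i < n) u ord0 i * v ord0 i.

(* The norm `|u| that the library puts on matrices is the sup norm. *)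
Definition enorm u : R := Num.sqrt (dot u u).

End euclidean.

(* The minimum of A, and 0 by convention if A is empty. *)
Definition nat_min (A : set nat) : nat :=
  xget 0%N [set k | A k /\ forall j, A j -> (k <= j)%N].

Section kernels.
Context {R : realType} {dS : measure_display} {S : measurableType dS}.
Local Open Scope ereal_scope.

Definition tv_dist (mu nu : set S -> \bar R) : \bar R :=
  ereal_sup [set `|mu A - nu A| | A in measurable].

(* The k-step transition probabilities P^k(x, A). *)
Fixpoint kernel_iter (P : S -> {measure set S -> \bar R}) (k : nat)
    (x : S) (A : set S) : \bar R :=
  if k is j.+1 then \int[P x]_y kernel_iter P j y A else \d_x A.

Definition sup_tv (P : R.-pker S ~> S) (mu : probability S R) (k : nat)
    : \bar R :=
  ereal_sup [set tv_dist (kernel_iter P k x) mu | x in [set: S]].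

Definition mixing_time (P : R.-pker S ~> S) (mu : probability S R) (delta : R)
    : nat :=
  nat_min [set k | sup_tv P mu k <= delta%:E].

Definition stationary (P : R.-pker S ~> S) (nu : probability S R) : Prop :=
  forall A, measurable A -> \int[nu]_x P x A = nu A.

Definition uniformly_ergodic (P : R.-pker S ~> S) (mu : probability S R)
    (C rho : R) : Prop :=
  [/\ (1 <= C)%R, (0 < rho < 1)%R,
      stationary P mu,
      (forall nu : probability S R, stationary P nu ->
         forall A, measurable A -> nu A = mu A)
    & forall k, sup_tv P mu k <= (C * rho ^+ k)%:E].

End kernels.

Section operator.
Context {R : realType} {dS : measure_display} {S : measurableType dS}.
Context {d : nat}.
Implicit Types F : S -> 'rV[R]_d -> 'rV[R]_d.

Definition mean_field (mu : probability S R) F (theta : 'rV[R]_d) : 'rV[R]_d :=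
  \row_(i < d) fine ('E_mu[fun x => F x theta ord0 i]).

(* Measurability of F(., theta) is what makes E[F(X, theta)] meaningful. *)
Definition lipschitz_operator F (L1 : R) : Prop :=
  [/\ 0 < L1,
      (forall theta, measurable_fun setT (fun x => F x theta)),
      (forall x theta1 theta2,
         enorm (F x theta1 - F x theta2) <= L1 * enorm (theta1 - theta2))
    & forall x, enorm (F x 0) <= L1].

Definition dissipative (mu : probability S R) F (theta_star : 'rV[R]_d)
    (c0 : R) : Prop :=
  [/\ 0 < c0,
      mean_field mu F theta_star = 0,
      (forall theta, mean_field mu F theta = 0 -> theta = theta_star)
    & forall theta,
        dot (theta - theta_star) (mean_field mu F theta)
          <= - c0 * enorm (theta - theta_star) ^+ 2].

End operator.

Section stepsizes.
Context {R : realType}.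

Definition stepsize (alpha xi h : R) (k : nat) : R :=
  alpha / ((k%:R + h) `^ xi).

Context {dS : measure_display} {S : measurableType dS}.

(* The sum alpha_(i,j) over i <= l <= j is written half-open, so that for
   j = k - 1 it is empty when i = k, including when k = 0. *)
Definition stepsize_condition (P : R.-pker S ~> S) (mu : probability S R)
    (c0 L : R) (al : nat -> R) : Prop :=
  [/\ nonincreasing_seq al,
      0 < al 0%N < 1
    & forall k, (mixing_time P mu (al k) <= k)%N ->
        \sum_(k - mixing_time P mu (al k) <= l < k) al l
          < c0 / (130 * L ^+ 2)].

End stepsizes.

Section processes.
Context {R : realType} {dS : measure_display} {S : measurableType dS}.
Context {dO : measure_display} {Omega : measurableType dO}.
Context {d : nat}.

Fixpoint sa_iterates (F : S -> 'rV[R]_d -> 'rV[R]_d) (al : nat -> R)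
    (X : nat -> Omega -> S) (w : nat -> Omega -> 'rV[R]_d)
    (theta0 : 'rV[R]_d) (k : nat) (omega : Omega) : 'rV[R]_d :=
  if k is j.+1 then
    let theta := sa_iterates F al X w theta0 j omega in
    theta + al j *: (F (X j omega) theta + w j omega)
  else theta0.

Definition sa_filtration (theta : nat -> Omega -> 'rV[R]_d)
    (X : nat -> Omega -> S) (w : nat -> Omega -> 'rV[R]_d) (k : nat)
    : set (set Omega) :=
  <<s \bigcup_(i in `I_k.+1) (preimage_set_system setT (theta i) measurable
                              `|` preimage_set_system setT (X i) measurable)
      `|` \bigcup_(i in `I_k) preimage_set_system setT (w i) measurable >>.

(* g is a version of the conditional expectation E[f | G]. *)
Definition is_cond_exp (Pr : probability Omega R) (G : set (set Omega))
    (f g : Omega -> R) : Prop :=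
  [/\ Pr.-integrable setT (EFin \o f),
      Pr.-integrable setT (EFin \o g),
      preimage_set_system setT g measurable `<=` G
    & forall A, G A ->
        (\int[Pr]_(omega in A) (f omega)%:E
         = \int[Pr]_(omega in A) (g omega)%:E)%E].

(* P(X_(k+1) \in B | G_k) = P(X_k, B). *)
Definition markov_chain (Pr : probability Omega R) (P : R.-pker S ~> S)
    (X : nat -> Omega -> S) (G : nat -> set (set Omega)) : Prop :=
  (forall k, measurable_fun setT (X k)) /\
  forall k B, measurable B ->
    is_cond_exp Pr (G k) (\1_(X k.+1 @^-1` B))
      (fun omega => fine (P (X k omega) B)).

Definition noise_condition (Pr : probability Omega R)
    (theta w : nat -> Omega -> 'rV[R]_d) (G : nat -> set (set Omega))
    (L2 : R) : Prop :=
  [/\ forall k, measurable_fun setT (w k),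
      forall k i, is_cond_exp Pr (G k) (fun omega => w k omega ord0 i) (cst 0)
    & forall k, {ae Pr, forall omega,
        enorm (w k omega) <= L2 * (enorm (theta k omega) + 1)}].

End processes.

(* Main.v *)
Require Import Defs.
From mathcomp Require Import all_boot all_order all_algebra.
From mathcomp Require Import all_classical all_reals all_analysis.
From mathcomp Require Import measurable_realfun ring lra.

Set Implicit Arguments.
Unset Strict Implicit.
Unset Printing Implicit Defensive.

Import Order.TTheory GRing.Theory Num.Theory.
Import numFieldNormedType.Exports.

Local Open Scope classical_set_scope.
Local Open Scope ring_scope.

(* The paper controls the Markovian bias E<theta_k - theta*, F(X_k, theta_k) -
   Fbar(theta_k)> by looking back t_k steps. That costs alpha_k t_k, which the
   constant L3 = log(C/rho)/log(1/rho) does not dominate when log(C/rho) < 1.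
   Here the bias is instead telescoped through the Poisson equation: with
   u_n(x, v) = <v - theta*, (P^n F(., v))(x) - Fbar(v)>, which is O(rho^n) by
   ergodicity, b_(k,n) = E[u_n(X_k, theta_k)] satisfies
   b_(k+1,n) = b_(k,n+1) + O(rho^n alpha_k), so g_k = sum_n b_(k,n) satisfies
   b_(k,0) = g_k - g_(k+1) + O(alpha_k). Hence W_k = E|theta_k - theta*|^2 +
   2 alpha_k g_k obeys W_(k+1) <= (1 - c0 alpha_k) W_k + O(alpha_k^2) wherever
   W_k is nonnegative. All constants hidden in the O's are independent of h, so
   for h large they are absorbed by the factor log((k+h)/alpha) of the bounds,
   and the initial transient by the slack beta1 - |theta_0 - theta*|^2 >= 1. *)

(** * Bounded measurable functions *)

Section bounded_measurable.
Context {d : measure_display} {T : measurableType d} {R : realType}.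
Implicit Types (D A : set T) (f g : T -> R).

(** The hypotheses speak of events and of fixed parameters, while the argument needs means of
    functions of the random pair (X_k, theta_k). Total variation and the Markov property are carried
    from indicators to bounded functions by a single comparison of functionals, used with t = 0 for
    the Markov property. A random theta_k is frozen by cutting space into finitely many cells, which
    is why Lipschitz bounds in the parameter are tracked everywhere. Integrals along the process are
    taken over one event of full probability on which each theta_k is bounded by a constant
    depending on k, so integrability is immediate. W_k may be negative, since g_k has no sign, so
    the recursion is run on its positive part. No decay is used before time K: the stepsize
    condition at K bounds the sum of the first K stepsizes independently of h, which makes the
    initial transient O(alpha_0). From K on, each rate amounts to one supersolution of the
    homogeneous recursion and one of the recursion forced by alpha_k^2. *)

Definition bmeas D f :=
  measurable_fun D f /\ exists M, forall x, D x -> `|f x| <= M.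

Lemma bmeas_cst D (c : R) : bmeas D (fun=> c).
Proof. by split; [exact: measurable_cst | exists `|c| => x _]. Qed.

Lemma bmeasD D f g : bmeas D f -> bmeas D g -> bmeas D (fun x => f x + g x).
Proof.
move=> [mf [M hM]] [mg [N hN]]; split; first exact: measurable_funD.
by exists (M + N) => x Dx; rewrite (le_trans (ler_normD _ _))// lerD// ?hM ?hN.
Qed.

Lemma bmeasM D f g : bmeas D f -> bmeas D g -> bmeas D (fun x => f x * g x).
Proof.
move=> [mf [M hM]] [mg [N hN]]; split; first exact: measurable_funM.
by exists (M * N) => x Dx; rewrite normrM ler_pM// ?hM ?hN.
Qed.

Lemma bmeasZ D (c : R) f : bmeas D f -> bmeas D (fun x => c * f x).
Proof. exact/bmeasM/bmeas_cst. Qed.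

Lemma bmeasB D f g : bmeas D f -> bmeas D g -> bmeas D (fun x => f x - g x).
Proof.
move=> bf bg; have := bmeasD bf (bmeasZ (-1) bg).
by under [X in bmeas D X]eq_fun do rewrite mulN1r.
Qed.

Lemma bmeas_sum D (I : Type) (s : seq I) (h : I -> T -> R) :
  (forall i, bmeas D (h i)) -> bmeas D (fun x => \sum_(i <- s) h i x).
Proof.
move=> bh; elim: s => [|i s IH].
  by under eq_fun do rewrite big_nil; exact: bmeas_cst.
by under eq_fun do rewrite big_cons; exact: bmeasD.
Qed.

Lemma bmeas_indic D A : measurable A -> bmeas D (\1_A).
Proof.
move=> mA; split; first exact: measurable_indic.
by exists 1 => x _; rewrite indicE normr_nat lern1 leq_b1.
Qed.

End bounded_measurable.

Lemma bmeas_comp d d' (T : measurableType d) (S : measurableType d')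
  (R : realType) (X : T -> S) (f : S -> R) (D : set T) :
  measurable_fun setT X -> bmeas setT f -> measurable D ->
  bmeas D (fun x => f (X x)).
Proof.
move=> mX [mf [M hM]] mD; split; last by exists M => x _; exact: hM.
by apply: measurable_funTS; exact: measurableT_comp.
Qed.

(** * Integrals of bounded functions over an event of mass at most one *)

Section mean.
Context {d : measure_display} {T : measurableType d} {R : realType}.
Context (mu : {measure set T -> \bar R}) (D : set T).
Context (mu1 : (mu D <= 1)%E).
Context (mD : measurable D).
Implicit Types (f g : T -> R).

Lemma bmeas_integrable f : bmeas D f -> mu.-integrable D (EFin \o f).
Proof.
move=> [mf [M hM]]; apply: measurable_bounded_integrable => //.
  by rewrite (le_lt_trans mu1)// ltry.
exists M; split; first exact: num_real.
by move=> N MN x Dx; rewrite /= (le_trans (hM _ Dx))// ltW.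
Qed.

Lemma meanD f g : bmeas D f -> bmeas D g ->
  \int[mu]_(x in D) (f x + g x) = \int[mu]_(x in D) f x + \int[mu]_(x in D) g x.
Proof. by move=> bf bg; rewrite RintegralD//; exact: bmeas_integrable. Qed.

Lemma meanZ (c : R) f : bmeas D f ->
  \int[mu]_(x in D) (c * f x) = c * \int[mu]_(x in D) f x.
Proof. by move=> bf; rewrite RintegralZl//; exact: bmeas_integrable. Qed.

Lemma meanB f g : bmeas D f -> bmeas D g ->
  \int[mu]_(x in D) (f x - g x) = \int[mu]_(x in D) f x - \int[mu]_(x in D) g x.
Proof. by move=> bf bg; rewrite RintegralB//; exact: bmeas_integrable. Qed.

Lemma mean0 : \int[mu]_(x in D) (0 : R) = 0.
Proof. by rewrite Rintegral_cst// mul0r. Qed.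

Lemma mean_sum (I : Type) (s : seq I) (h : I -> T -> R) :
  (forall i, bmeas D (h i)) ->
  \int[mu]_(x in D) (\sum_(i <- s) h i x) =
    \sum_(i <- s) \int[mu]_(x in D) h i x.
Proof.
move=> bh; elim: s => [|i s IH].
  by under eq_Rintegral do rewrite big_nil; rewrite big_nil mean0.
under eq_Rintegral do rewrite big_cons.
by rewrite big_cons meanD ?IH//; exact: bmeas_sum.
Qed.

Lemma mean_le f g : bmeas D f -> bmeas D g -> (forall x, D x -> f x <= g x) ->
  \int[mu]_(x in D) f x <= \int[mu]_(x in D) g x.
Proof. by move=> bf bg fg; apply: le_Rintegral => //; exact: bmeas_integrable. Qed.

Lemma mean_norm f g : bmeas D f -> bmeas D g ->
  (forall x, D x -> `|f x| <= g x) ->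
  `|\int[mu]_(x in D) f x| <= \int[mu]_(x in D) g x.
Proof.
move=> bf bg fg; rewrite ler_norml; apply/andP; split; last first.
  by apply: mean_le => // x /fg; rewrite ler_norml => /andP[].
rewrite lerNl -mulN1r -meanZ//; apply: mean_le => //; first exact: bmeasZ.
by move=> x /fg; rewrite ler_norml mulN1r lerNl => /andP[].
Qed.

Lemma mean_bound f (M : R) : bmeas D f -> 0 <= M ->
  (forall x, D x -> `|f x| <= M) -> `|\int[mu]_(x in D) f x| <= M.
Proof.
move=> bf M0 fM; rewrite (le_trans (mean_norm bf (bmeas_cst _ M) fM))//.
rewrite Rintegral_cst// ler_piMr// -lee_fin fineK//.
by rewrite ge0_fin_numE// (le_lt_trans mu1)// ltry.
Qed.

Lemma meanE f : bmeas D f ->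
  (\int[mu]_(x in D) (f x)%:E)%E = (\int[mu]_(x in D) f x)%:E.
Proof.
by move=> bf; rewrite fineK//; apply: integrable_fin_num => //; exact: bmeas_integrable.
Qed.

End mean.

(** * From events to bounded functions *)

Section layer_cake.
Context {d : measure_display} {T : measurableType d} {R : realType}.
Implicit Types (I J : (T -> R) -> R) (f g : T -> R).

(** Common interface for the iterated kernel at a point, the mean under [mu], and expectations along
    the process. *)
Definition bounded_functional I :=
  [/\ forall f g, bmeas setT f -> bmeas setT g ->
        I (fun x => f x + g x) = I f + I g,
      forall c f, bmeas setT f -> I (fun x => c * f x) = c * I f
    & forall f (M : R), bmeas setT f -> 0 <= M ->
        (forall x, `|f x| <= M) -> `|I f| <= M].

Lemma bounded_functional_sum I (s : seq nat) (h : nat -> T -> R) :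
  bounded_functional I -> (forall i, bmeas setT (h i)) ->
  I (fun x => \sum_(i <- s) h i x) = \sum_(i <- s) I (h i).
Proof.
move=> [ID IZ _] bh; elim: s => [|i s IH].
  under eq_fun do rewrite big_nil.
  rewrite big_nil -[RHS](mul0r (I (fun=> 0))) -IZ; last exact: bmeas_cst.
  by congr I; apply/funext => x; rewrite mul0r.
under eq_fun do rewrite big_cons.
by rewrite big_cons ID ?IH//; exact: bmeas_sum.
Qed.

(** The sum is the integer part of y, written as a count of thresholds so that the integer part of a
    function becomes a sum of indicators. *)
Lemma sum_thresholds (y : R) (m : nat) : 0 <= y <= m%:R ->
  y - 1 <= \sum_(j < m) (j.+1%:R <= y)%R%:R <= y.
Proof.
move=> /andP[y0 ym].
(* The induction on the number of thresholds also records saturation: the count equals k once y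
   reaches k. *)
suff H k : [/\ \sum_(j < k) (j.+1%:R <= y)%R%:R <= y,
    (y <= k%:R -> y - 1 <= \sum_(j < k) (j.+1%:R <= y)%R%:R) &
    (k%:R <= y -> \sum_(j < k) (j.+1%:R <= y)%R%:R = k%:R :> R)].
  by have [-> /(_ ym) -> _] := H m.
elim: k => [|k [h1 h2 h3]].
  by rewrite big_ord0; split => // yk; lra.
rewrite big_ord_recr /= -natr1; case: (leP (k%:R + 1) y) => ky /=.
  have e : \sum_(j < k) (j.+1%:R <= y)%R%:R = k%:R :> R by apply: h3; lra.
  by rewrite e; split => // ?; lra.
rewrite addr0; split => // yk.
have [/h2//|/ltW/h3 ->] := leP y k%:R; lra.
Qed.

(** Up to 1/m, g is the average of the indicators of its m superlevel sets g >= j/m. I and J differ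
    by at most t on each of them, hence by at most t on the average. *)
Lemma layer_cake I J (t : R) g : bounded_functional I -> bounded_functional J ->
  (forall A, measurable A -> `|I \1_A - J \1_A| <= t) ->
  measurable_fun setT g -> (forall x, 0 <= g x <= 1) -> `|I g - J g| <= t.
Proof.
move=> bI bJ IJ mg g01.
have bg : bmeas setT g.
  split=> //; exists 1 => x _; rewrite ger0_norm; by have /andP[] := g01 x.
apply/ler_addgt0Pr => e e0.
(* The discretization costs 1/m for I and 1/m for J, so 2/m <= e suffices. *)
pose m := (Num.truncn (2 / e)).+1.
have m0 : 0 < m%:R :> R by rewrite ltr0n.
have me : 2 * m%:R^-1 <= e.
  have := truncnS_gt (2 / e); rewrite -/m ltr_pdivrMr// => /ltW h.
  by rewrite ler_pdivrMr// mulrC.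
pose A (j : nat) := [set x | j.+1%:R <= m%:R * g x].
have mA j : measurable (A j).
  have : measurable_fun setT (fun x => j.+1%:R <= m%:R * g x).
    apply: measurable_fun_ler; first exact: measurable_cst.
    exact: measurable_funM.
  move=> /(_ measurableT [set true] Logic.I); rewrite setTI.
  by congr measurable; apply/seteqP; split => x.
pose gm x : R := \sum_(j < m) m%:R^-1 * \1_(A j) x.
have bA j : bmeas setT (fun x => m%:R^-1 * \1_(A j) x).
  by apply/bmeasZ/bmeas_indic.
have bgm : bmeas setT gm by exact: bmeas_sum.
have dg x : `|g x - gm x| <= m%:R^-1.
  have /andP[g0 g1] := g01 x.
  have := @sum_thresholds (m%:R * g x) m.
  rewrite mulr_ge0//= ler_piMr// => /(_ isT) /andP[h1 h2].
  have e1 : m%:R * gm x = \sum_(j < m) (j.+1%:R <= m%:R * g x)%R%:R.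
    rewrite /gm mulr_sumr; apply: eq_bigr => j _.
    rewrite mulrA divff ?gt_eqF// mul1r indicE; congr (nat_of_bool _)%:R.
    by apply/idP/idP; rewrite inE.
  rewrite -e1 in h1 h2.
  rewrite -(ler_pM2l m0) divff ?gt_eqF// -[X in X * _]gtr0_norm// -normrM mulrBr.
  by rewrite ler_norml; lra.
have IJm : `|I gm - J gm| <= t.
  have -> : gm = (fun x => \sum_(j <- iota 0 m) m%:R^-1 * \1_(A j) x).
    apply/funext => x; rewrite /gm.
    by rewrite -(big_mkord predT (fun j => m%:R^-1 * \1_(A j) x)) /index_iota subn0.
  rewrite !bounded_functional_sum//.
  rewrite -sumrB (le_trans (ler_norm_sum _ _ _))//.
  have [_ IZ _] := bI; have [_ JZ _] := bJ.
  have h j : `|I (fun x => m%:R^-1 * \1_(A j) x) - J (fun x => m%:R^-1 * \1_(A j) x)|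
     <= m%:R^-1 * t.
    rewrite IZ ?JZ; [|exact: bmeas_indic..].
    by rewrite -mulrBr normrM gtr0_norm ?invr_gt0// ler_wpM2l ?invr_ge0 ?ler0n// IJ.
  apply: (le_trans (ler_sum _ (fun j _ => h j))).
  rewrite big_const_seq count_predT size_iota iter_addr addr0.
  by rewrite -mulrnAl -mulr_natr mulVf ?mul1r// gt_eqF.
have ebound K : bounded_functional K -> `|K g - K gm| <= m%:R^-1.
  move=> [KD KZ KM].
  have -> : K g - K gm = K (fun x => g x + (-1) * gm x).
    by rewrite KD ?KZ ?mulN1r//; exact: bmeasZ.
  apply: KM; [exact/bmeasD/bmeasZ|by rewrite invr_ge0|move=> x; rewrite mulN1r; exact: dg].
have := ebound _ bI; have := ebound _ bJ.
move: IJm me; rewrite !ler_norml => /andP[? ?] ? /andP[? ?] /andP[? ?].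
by apply/andP; split; lra.
Qed.

(* An affine change of variable brings [-M, M] to [0, 1]. *)
Lemma functional_dist I J (t : R) f (M : R) :
  bounded_functional I -> bounded_functional J ->
  (forall A, measurable A -> `|I \1_A - J \1_A| <= t) ->
  measurable_fun setT f -> 0 <= M -> (forall x, `|f x| <= M) ->
  `|I f - J f| <= 3 * M * t.
Proof.
move=> bI bJ IJ mf M0 fM.
have [ID IZ IM] := bI; have [JD JZ JM] := bJ.
have bf : bmeas setT f by split=> //; exists M.
(* M = 0 is separate because the rescaling divides by 2M. *)
move: M0; rewrite le_eqVlt => /orP[/eqP M0|M0].
  have z K : bounded_functional K -> K f = 0.
    move=> [_ _ KM]; apply/eqP; rewrite -normr_le0 [leRHS]M0.
    by apply: KM; rewrite ?M0// -M0.
  by rewrite (z _ bI) (z _ bJ) subrr normr0 -M0 mulr0 mul0r.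
pose g x := (2 * M)^-1 * (f x + M).
have b1 : bmeas setT (\1_setT : T -> R) by exact: bmeas_indic.
have bg : bmeas setT g by apply/bmeasZ/bmeasD/bmeas_cst.
have M2 : 0 < 2 * M by rewrite mulr_gt0.
have hg : `|I g - J g| <= t.
  apply: layer_cake => //; first exact: bg.1.
  move=> x; have := fM x; rewrite ler_norml => /andP[h1 h2].
  rewrite /g ler_pdivrMl// mulr1 mulr_ge0 ?invr_ge0 ?(ltW M2)//=; lra.
have fE : f = (fun x => 2 * M * g x + (- M) * \1_setT x).
  apply/funext => x; rewrite indicT /= /g mulr1 mulrA divff ?gt_eqF//; ring.
have E K : bounded_functional K -> K f = 2 * M * K g - M * K \1_setT.
  move=> [KD KZ _]; rewrite {1}fE.
  by rewrite (KD _ _ (bmeasZ (2 * M) bg) (bmeasZ (- M) b1)) (KZ _ _ bg) (KZ _ _ b1) mulNr.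
rewrite (E _ bI) (E _ bJ).
(* I and J are not assumed to agree on constants: 3 is 2 for g plus 1 for the total mass. *)
have -> : 2 * M * I g - M * I \1_setT - (2 * M * J g - M * J \1_setT) =
  2 * M * (I g - J g) - M * (I \1_setT - J \1_setT) by ring.
rewrite (le_trans (ler_normB _ _))// !normrM (gtr0_norm M0) [`|2|]gtr0_norm//.
have h1 := ler_wpM2l (ltW M0) hg.
have h2 := ler_wpM2l (ltW M0) (IJ _ measurableT).
lra.
Qed.

End layer_cake.

(** * The transition operator and its iterates *)

Section kernel_operator.
Context {dS : measure_display} {S : measurableType dS} {R : realType}.
Context (P : R.-pker S ~> S).
Implicit Types (f g : S -> R).

Definition kop f (x : S) : R := \int[P x]_y f y.

Let P1 x : (P x setT <= 1)%E. Proof. by rewrite prob_kernel. Qed.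

Lemma bmeas_kop f : bmeas setT f -> bmeas setT (kop f).
Proof.
move=> bf; have [mf [M hM]] := bf; split; last first.
  exists `|M| => x _; apply: mean_bound => //.
  by move=> y Dy; rewrite (le_trans (hM _ Dy))// ler_norm.
(* Adding M makes the integrand nonnegative, as the measurability of kernel integrals requires. *)
have -> : kop f = (fun x => fine (\int[P x]_y (f y + M)%:E)%E - M).
  apply/funext => x.
  have bM : bmeas setT (fun=> M : R) by move=> *; exact: bmeas_cst.
  rewrite -/(Rintegral (P x) setT (fun y => f y + M)) (meanD (P1 x))//.
  by rewrite Rintegral_cst// prob_kernel mulr1 addrK.
apply: measurable_funB; last exact: measurable_cst.
apply: measurableT_comp => //; apply: measurable_fun_integral_kernel.
- by move=> U mU; exact: measurable_kernel.
- by move=> z; rewrite lee_fin -lerBlDr sub0r; have := hM z I; rewrite ler_norml => /andP[].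
- by apply/measurable_EFinP/measurable_funD.
Qed.

Lemma bmeas_iter_kop n f : bmeas setT f -> bmeas setT (iter n kop f).
Proof. by move=> bf; elim: n => //= n; exact: bmeas_kop. Qed.

Lemma kopD f g : bmeas setT f -> bmeas setT g ->
  kop (fun x => f x + g x) = fun x => kop f x + kop g x.
Proof. by move=> bf bg; apply/funext => x; rewrite /kop meanD. Qed.

Lemma kopZ c f : bmeas setT f -> kop (fun x => c * f x) = fun x => c * kop f x.
Proof. by move=> bf; apply/funext => x; rewrite /kop meanZ. Qed.

Lemma kop_bound f (M : R) : bmeas setT f -> 0 <= M ->
  (forall x, `|f x| <= M) -> forall x, `|kop f x| <= M.
Proof. by move=> bf M0 hM x; apply: mean_bound. Qed.

Lemma bounded_functional_iter_kop n x :
  bounded_functional (fun f => iter n kop f x).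
Proof.
(* The induction needs identities between functions, not values at x, since [kop] averages over all
   states. *)
suff H m : [/\ forall f g, bmeas setT f -> bmeas setT g ->
        iter m kop (fun x => f x + g x) = fun x => iter m kop f x + iter m kop g x,
      forall c f, bmeas setT f -> iter m kop (fun x => c * f x) = fun x => c * iter m kop f x
    & forall f (M : R), bmeas setT f -> 0 <= M ->
        (forall x, `|f x| <= M) -> forall x, `|iter m kop f x| <= M].
  have [HD HZ HM] := H n; split=> [f g bf bg|c f bf|f M bf M0 hM].
  - by rewrite HD.
  - by rewrite HZ.
  - exact: HM.
elim: m => [|m [HD HZ HM]]; first by split.
split=> [f g bf bg|c f bf|f M bf M0 hM] /=.
- by rewrite HD// kopD//; exact: bmeas_iter_kop.
- by rewrite HZ// kopZ//; exact: bmeas_iter_kop.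
- by apply: kop_bound => //; [exact: bmeas_iter_kop | exact: HM].
Qed.

Lemma kernel_iterE n x A : measurable A ->
  kernel_iter P n x A = (iter n kop \1_A x)%:E.
Proof.
move=> mA; elim: n x => [x|n IH x] /=; first by rewrite diracE indicE.
under eq_integral do rewrite IH.
by rewrite (meanE (P1 x))//; apply/bmeas_iter_kop/bmeas_indic.
Qed.

Lemma bounded_functional_mean (mu : probability S R) :
  bounded_functional (fun f => \int[mu]_x f x).
Proof.
have mu1 : (mu setT <= 1)%E by rewrite probability_setT.
split=> [f g bf bg|c f bf|f M bf M0 hM].
- by rewrite (meanD mu1).
- by rewrite (meanZ mu1).
- by apply: (mean_bound mu1).
Qed.

(** Total variation controls events only; [functional_dist] extends this to bounded f, uniformly in
    x because [sup_tv] is a supremum over starting states. *)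
Lemma iter_kop_mean_dist (mu : probability S R) n (t : R) f (M : R) :
  (sup_tv P mu n <= t%:E)%E -> bmeas setT f -> 0 <= M ->
  (forall x, `|f x| <= M) ->
  forall x, `|iter n kop f x - \int[mu]_y f y| <= 3 * M * t.
Proof.
move=> tv [mf _] M0 hM x.
apply: (functional_dist (bounded_functional_iter_kop n x)
         (bounded_functional_mean mu)) => // A mA.
have mu1 : (mu setT <= 1)%E by rewrite probability_setT.
rewrite -lee_fin; apply: le_trans tv.
apply: (@le_trans _ _ (tv_dist (kernel_iter P n x) mu)); last first.
  by apply: ereal_sup_ubound; exists x.
apply: ereal_sup_ubound; exists A => //.
rewrite kernel_iterE//.
have -> : mu A = (\int[mu]_y \1_A y)%:E.
  by rewrite -(meanE mu1)//; [rewrite integral_indic// setIT|exact: bmeas_indic].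
by rewrite -EFinB.
Qed.

End kernel_operator.

(** * Norms and measurability of row vectors *)

Section row_vectors.
Context {R : realType} {n : nat}.
Implicit Types u v : 'rV[R]_n.

(** Suited to coordinatewise estimates; the dimension factor lost against [enorm] only enters
    constants independent of h. *)
Definition l1norm v : R := \sum_(i < n) `|v ord0 i|.

Lemma l1norm_ge0 v : 0 <= l1norm v.
Proof. by apply: sumr_ge0. Qed.

Lemma l1normD u v : l1norm (u + v) <= l1norm u + l1norm v.
Proof.
by rewrite -big_split; apply: ler_sum => i _; rewrite mxE ler_normD.
Qed.

Lemma l1normB u v : l1norm (u - v) = l1norm (v - u).
Proof. by apply: eq_bigr => i _; rewrite !mxE distrC. Qed.

Lemma coord_le_l1norm v i : `|v ord0 i| <= l1norm v.
Proof. by rewrite /l1norm (bigD1 i)//= lerDl sumr_ge0. Qed.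

Lemma enorm_ge0 v : 0 <= enorm v.
Proof. exact: sqrtr_ge0. Qed.

Lemma dotvv_ge0 v : 0 <= dot v v.
Proof. by apply: sumr_ge0 => i _; rewrite -expr2 sqr_ge0. Qed.

Lemma sqr_enorm v : enorm v ^+ 2 = dot v v.
Proof. by rewrite sqr_sqrtr// dotvv_ge0. Qed.

Lemma coord_le_enorm v i : `|v ord0 i| <= enorm v.
Proof.
rewrite -sqrtr_sqr ler_wsqrtr// /dot (bigD1 i)//= -expr2 lerDl.
by apply: sumr_ge0 => j _; rewrite -expr2 sqr_ge0.
Qed.

Lemma l1norm_le_enorm v : l1norm v <= n%:R * enorm v.
Proof.
apply: (le_trans (ler_sum _ (fun i _ => coord_le_enorm v i))).
by rewrite sumr_const card_ord mulr_natl.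
Qed.

Lemma enorm_le_l1norm v : enorm v <= l1norm v.
Proof.
rewrite -(ger0_norm (l1norm_ge0 v)) -sqrtr_sqr ler_wsqrtr// expr2 {1}/l1norm mulr_suml.
apply: ler_sum => i _; rewrite (le_trans (ler_norm _))// normrM ler_wpM2l//.
exact: coord_le_l1norm.
Qed.

Lemma measurable_coord i : measurable_fun setT (fun v : 'rV[R]_n => v ord0 i).
Proof.
move=> _ B mB; apply: sub_sigma_algebra; exists (ord0, i) => //=.
by exists B.
Qed.

Lemma measurable_rowP d (T : measurableType d) (f : T -> 'rV[R]_n) :
  measurable_fun setT f <->
  forall i, measurable_fun setT (fun x => f x ord0 i).
Proof.
split=> [mf i|mf]; first by apply: (measurableT_comp (measurable_coord i) mf).
apply: (@measurability _ _ _ _ _ _ (@entry_sets _ (measurableTypeR R) 1 n)) => //.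
move=> _ [A [[i j] _ [B mB <-]] <-] /=; rewrite !setTI.
have := mf j measurableT B mB; rewrite setTI.
by congr measurable; apply/seteqP; split => x /=; rewrite (ord1 i).
Qed.

End row_vectors.

(** * A finite grid on the parameter space *)

Section grid.
Context {R : realType} {n : nat}.
Implicit Types v : 'rV[R]_n.

(** The integer part of y clamped to [0, N]; the clamp keeps cell indices in a finite type. *)
Definition thresholds (N : nat) (y : R) : nat := \sum_(j < N) (j.+1%:R <= y)%R.

Lemma thresholdsP (N : nat) (y : R) : 0 <= y <= N%:R ->
  y - 1 <= (thresholds N y)%:R <= y.
Proof. by move=> /sum_thresholds; rewrite /thresholds natr_sum. Qed.

Lemma thresholds_le N y : (thresholds N y <= N)%N.
Proof.
rewrite -[leqRHS]card_ord -sum1_card; apply: leq_sum => i _.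
by case: (_ <= _)%R.
Qed.

Lemma measurable_thresholds N k :
  measurable [set y : measurableTypeR R | thresholds N y = k].
Proof.
have mt : measurable_fun setT (fun y : measurableTypeR R => (thresholds N y)%:R : R).
  rewrite /thresholds; under eq_fun do rewrite natr_sum.
  apply: measurable_sum => j.
  rewrite (_ : (fun _ => _) = \1_(`[j.+1%:R, +oo[%classic)).
    exact: measurable_indic.
  apply/funext => y; rewrite indicE; congr (nat_of_bool _)%:R.
  by apply/idP/idP; rewrite inE /= in_itv/= andbT.
have := mt measurableT [set k%:R] (measurable_set1 _); rewrite setTI.
congr measurable; apply/seteqP; split => y /=; last by move=> ->.
by move/eqP; rewrite eqr_nat => /eqP.
Qed.

(** Number of cells along one axis: length 2(m+1) over side 1/(m+1). The index [N m] itself occurs,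
    on and beyond the top face. *)
Let N (m : nat) := (2 * m.+1 * m.+1)%N.

(* The cube [-(m+1), m+1]^n is cut into cells of side 1/(m+1). *)
Definition cell m v : {ffun 'I_n -> 'I_(N m).+1} :=
  [ffun i => inord (thresholds (N m) (m.+1%:R * (v ord0 i + m.+1%:R)))].

(** The representative is the corner with the smallest coordinates, the one that rounding down
    yields. *)
Definition cell_point m (q : {ffun 'I_n -> 'I_(N m).+1}) : 'rV[R]_n :=
  \row_i ((q i)%:R / m.+1%:R - m.+1%:R).

Lemma cell_close m v : l1norm v <= m.+1%:R ->
  l1norm (cell_point (cell m v) - v) <= n%:R / m.+1%:R.
Proof.
move=> vm; have m0 : 0 < m.+1%:R :> R by rewrite ltr0n.
apply: (@le_trans _ _ (\sum_(i < n) m.+1%:R^-1)); last first.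
  by rewrite sumr_const card_ord mulr_natl.
apply: ler_sum => i _; rewrite !mxE ffunE inordK ?ltnS ?thresholds_le//.
have := le_trans (coord_le_l1norm v i) vm; rewrite ler_norml => /andP[h1 h2].
have := @thresholdsP (N m) (m.+1%:R * (v ord0 i + m.+1%:R)).
have e : (N m)%:R = m.+1%:R * (2 * m.+1%:R) :> R by rewrite /N !natrM; ring.
rewrite e ler_pM2l// mulr_ge0/= ?(ltW m0)//; last lra.
have -> : v ord0 i + m.+1%:R <= 2 * m.+1%:R by lra.
set t := (thresholds _ _)%:R => /(_ isT) /andP[h3 h4].
rewrite -(ler_pM2l m0) divff ?gt_eqF// -[X in X * _]gtr0_norm// -normrM.
have -> : m.+1%:R * (t / m.+1%:R - m.+1%:R - v ord0 i) =
          t - m.+1%:R * (v ord0 i + m.+1%:R) by field; rewrite gt_eqF.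
by rewrite ler_norml; lra.
Qed.

Lemma measurable_cell m q : measurable [set v | cell m v = q].
Proof.
rewrite (_ : [set v | _] = \bigcap_(i in [set: 'I_n])
    ((fun v => m.+1%:R * (v ord0 i + m.+1%:R)) @^-1`
      [set y | inord (thresholds (N m) y) = q i])); last first.
  apply/seteqP; split=> [v /= <- i _ /=|v /= h]; first by rewrite ffunE.
  by apply/ffunP => i; rewrite ffunE; exact: h.
apply: fin_bigcap_measurable; first exact: finite_finset.
move=> i _; rewrite -[X in measurable X]setTI.
have mf : measurable_fun setT (fun v : 'rV[R]_n => m.+1%:R * (v ord0 i + m.+1%:R)).
  apply: measurable_funM; first exact: measurable_cst.
  by apply: measurable_funD; [exact: measurable_coord|exact: measurable_cst].
apply: mf => //.
rewrite (_ : [set y | _] = [set y | thresholds (N m) y = q i]).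
  exact: measurable_thresholds.
apply/seteqP; split=> y /=; last by move=> ->; rewrite inord_val.
by move=> <-; rewrite inordK// ltnS thresholds_le.
Qed.

(** Only the cell containing [th x] contributes. The right side is a finite sum whose parameters no
    longer depend on x. *)
Lemma cell_sum d (T : measurableType d) (th : T -> 'rV[R]_n)
    (Phi : T -> 'rV[R]_n -> R) m x :
  Phi x (cell_point (cell m (th x))) =
  \sum_(q <- enum {ffun 'I_n -> 'I_(N m).+1})
    \1_(th @^-1` [set v | cell m v = q]) x * Phi x (cell_point q).
Proof.
rewrite big_enum/= (bigD1 (cell m (th x)))//= indicE mem_set//= mul1r.
rewrite big1 ?addr0// => q qc; rewrite indicE memNset ?mul0r//= => e.
by rewrite e eqxx in qc.
Qed.

End grid.

(** * Substituting a random parameter *)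

Section freezing.
Context {d : measure_display} {T : measurableType d} {R : realType} {n : nat}.
Implicit Types (D : set T) (Phi Psi : T -> 'rV[R]_n -> R) (th : T -> 'rV[R]_n).

(** Uniform in x, but only on balls: the bias grows quadratically in its parameter and has no global
    Lipschitz constant. *)
Definition ball_lipschitz D Phi := forall M, exists2 Lam : R, 0 <= Lam &
  forall x u v, D x -> l1norm u <= M -> l1norm v <= M ->
    `|Phi x u - Phi x v| <= Lam * l1norm (u - v).

Lemma ball_lipschitz_cell D Phi th (M : R) : ball_lipschitz D Phi ->
  exists2 Lam : R, 0 <= Lam & forall m x, D x -> l1norm (th x) <= M ->
    M <= m.+1%:R -> `|Phi x (cell_point (cell m (th x))) - Phi x (th x)| <=
       Lam / m.+1%:R.
Proof.
(* The radius M + n also contains the cell points, which lie within n/(m+1) of the ball of radius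
   M. *)
move=> /(_ (M + n%:R))[Lam Lam0 LP]; exists (Lam * n%:R) => [|m x Dx xM Mm].
  by rewrite mulr_ge0.
have h := cell_close (le_trans xM Mm).
rewrite (le_trans (LP x _ _ Dx _ _))//.
- rewrite -[X in l1norm X](subrK (th x)) (le_trans (l1normD _ _))// addrC lerD//.
  by rewrite (le_trans h)// ler_piMr// invf_le1 ?ltr0n// ler1n.
- by rewrite (le_trans xM)// lerDl.
- by rewrite -mulrA ler_wpM2l.
Qed.

(** The grid discretizations are finite sums of measurable functions and, by the Lipschitz bound,
    converge pointwise. *)
Lemma measurable_caratheodory D Phi th : measurable D ->
  measurable_fun setT th -> (forall v, measurable_fun D (Phi ^~ v)) ->
  ball_lipschitz D Phi -> measurable_fun D (fun x => Phi x (th x)).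
Proof.
move=> mD mth mPhi lPhi.
apply: (@measurable_fun_cvg _ _ _ D
  (fun m x => Phi x (cell_point (cell m (th x))))) => [m|x Dx].
  under eq_fun do rewrite cell_sum.
  apply: measurable_sum => q; apply: measurable_funM => //.
  apply: measurable_indic; rewrite -[X in measurable X]setTI.
  by apply: mth => //; exact: measurable_cell.
have [Lam Lam0 h] := ball_lipschitz_cell th (l1norm (th x)) lPhi.
apply/cvgrPdist_le => e e0.
near=> m.
rewrite distrC (le_trans (h _ _ Dx _ _))//.
- rewrite (le_trans (ltW (truncnS_gt _)))// ler_nat ltnS.
  by near: m; exact: nbhs_infty_ge.
- rewrite ler_pdivrMr// mulrC -ler_pdivrMr//.
  rewrite (le_trans (ltW (truncnS_gt _)))// ler_nat ltnS.
  by near: m; exact: nbhs_infty_ge.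
Unshelve. all: by end_near. Qed.

Lemma bmeas_freeze D Phi th (M : R) : measurable D ->
  measurable_fun setT th -> (forall v, bmeas D (Phi ^~ v)) ->
  ball_lipschitz D Phi -> (forall x, D x -> l1norm (th x) <= M) ->
  bmeas D (fun x => Phi x (th x)).
Proof.
move=> mD mth bPhi lPhi thM; split.
  by apply: measurable_caratheodory => // v; have [] := bPhi v.
have [_ [K hK]] := bPhi 0; have [Lam Lam0 LP] := lPhi `|M|.
exists (K + Lam * `|M|) => x Dx.
rewrite -[X in `|X|](subrK (Phi x 0)) addrC (le_trans (ler_normD _ _))// lerD ?hK//.
have xM : l1norm (th x) <= `|M| by rewrite (le_trans (thM _ Dx))// ler_norm.
rewrite (le_trans (LP x _ _ Dx _ _))//.
  by rewrite /l1norm big1// => i _; rewrite mxE normr0.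
by rewrite subr0 ler_wpM2l.
Qed.

(* Replacing th by the centre of its cell turns both sides into finite sums of
   integrals with th frozen; the error is O(1/m). *)
Lemma freezing (Pr : {measure set T -> \bar R}) D Phi Psi th (M : R) :
  (Pr D <= 1)%E -> measurable D -> measurable_fun setT th ->
  (forall v, bmeas D (Phi ^~ v)) -> (forall v, bmeas D (Psi ^~ v)) ->
  ball_lipschitz D Phi -> ball_lipschitz D Psi ->
  (forall x, D x -> l1norm (th x) <= M) ->
  (forall v B, measurable B ->
    \int[Pr]_(x in D) (\1_(th @^-1` B) x * Phi x v) =
    \int[Pr]_(x in D) (\1_(th @^-1` B) x * Psi x v)) ->
  \int[Pr]_(x in D) Phi x (th x) = \int[Pr]_(x in D) Psi x (th x).
Proof.
move=> Pr1 mD mth bPhi bPsi lPhi lPsi thM PhiPsi.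
pose frozen (Xi : T -> 'rV[R]_n -> R) m x := Xi x (cell_point (cell m (th x))).
have mcell m q : measurable (th @^-1` [set v | cell m v = q]).
  by rewrite -[X in measurable X]setTI; apply: mth => //; exact: measurable_cell.
have bfrozen Xi m : (forall v, bmeas D (Xi ^~ v)) -> bmeas D (frozen Xi m).
  move=> bXi; rewrite /frozen; under eq_fun do rewrite cell_sum.
  by apply: bmeas_sum => q; apply: bmeasM => //; exact: bmeas_indic.
have frozenE m : \int[Pr]_(x in D) frozen Phi m x = \int[Pr]_(x in D) frozen Psi m x.
  rewrite /frozen; under eq_Rintegral do rewrite cell_sum.
  under [RHS]eq_Rintegral do rewrite cell_sum.
  rewrite !(mean_sum Pr1 mD); last 2 first.
  - by move=> q; apply: bmeasM => //; exact: bmeas_indic.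
  - by move=> q; apply: bmeasM => //; exact: bmeas_indic.
  by apply: eq_bigr => q _; apply: PhiPsi; exact: measurable_cell.
have close Xi : (forall v, bmeas D (Xi ^~ v)) -> ball_lipschitz D Xi ->
    exists2 Lam : R, 0 <= Lam & forall m, M <= m.+1%:R ->
      `|\int[Pr]_(x in D) frozen Xi m x - \int[Pr]_(x in D) Xi x (th x)| <=
      Lam / m.+1%:R.
  move=> bXi lXi; have [Lam Lam0 h] := ball_lipschitz_cell th M lXi.
  have bth := bmeas_freeze mD mth bXi lXi thM.
  exists Lam => // m Mm; rewrite -(meanB Pr1 mD)//; last exact: bfrozen.
  apply: (mean_bound Pr1 mD); first exact/bmeasB/bth/bfrozen.
    by rewrite divr_ge0.
  by move=> x Dx; apply: h => //; exact: thM.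
have [L1 L10 h1] := close _ bPhi lPhi; have [L2 L20 h2] := close _ bPsi lPsi.
apply/eqP; rewrite -subr_eq0 -normr_le0; apply/ler_addgt0Pr => e e0; rewrite add0r.
pose m := maxn (Num.truncn M) (Num.truncn ((L1 + L2) / e)).
have Mm : M <= m.+1%:R.
  by rewrite (le_trans (ltW (truncnS_gt _)))// ler_nat ltnS leq_maxl.
have em : L1 / m.+1%:R + L2 / m.+1%:R <= e.
  rewrite -mulrDl ler_pdivrMr// mulrC -ler_pdivrMr//.
  by rewrite (le_trans (ltW (truncnS_gt _)))// ler_nat ltnS leq_maxr.
move: em (h1 m Mm) (h2 m Mm); rewrite frozenE.
move: (L1 / _) (L2 / _) => a b; rewrite !ler_norml => ? /andP[? ?] /andP[? ?].
by apply/andP; split; lra.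
Qed.

End freezing.

(** * The bias and its geometric decay *)

Section residual.
Context {R : realType} {dS : measure_display} {S : measurableType dS} {d : nat}.
Context (P : R.-pker S ~> S) (mu : probability S R) (F : S -> 'rV[R]_d -> 'rV[R]_d).
Context (L1 C rho : R).
Context (hF : lipschitz_operator F L1) (herg : uniformly_ergodic P mu C rho).
Implicit Types (u v ts : 'rV[R]_d).

Lemma bmeas_operator v i : bmeas setT (fun x => F x v ord0 i).
Proof.
have [_ mF lF F0] := hF; split; first exact: (measurable_rowP _).1 (mF v) i.
exists (L1 * enorm (v - 0) + L1) => x _.
have -> : F x v ord0 i = (F x v - F x 0) ord0 i + F x 0 ord0 i.
  by rewrite !mxE subrK.
rewrite (le_trans (ler_normD _ _))// lerD//.
- exact: le_trans (coord_le_enorm _ _) (lF _ _ _).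
- exact: le_trans (coord_le_enorm _ _) (F0 _).
Qed.

Lemma operator_bound v i x : `|F x v ord0 i| <= L1 * (enorm v + 1).
Proof.
have [_ mF lF F0] := hF.
have -> : F x v ord0 i = (F x v - F x 0) ord0 i + F x 0 ord0 i.
  by rewrite !mxE subrK.
rewrite (le_trans (ler_normD _ _))// mulrDr mulr1 lerD//.
- by rewrite (le_trans (coord_le_enorm _ _))// (le_trans (lF _ _ _))// subr0.
- exact: le_trans (coord_le_enorm _ _) (F0 _).
Qed.

Lemma mean_fieldE v i : mean_field mu F v ord0 i = \int[mu]_x F x v ord0 i.
Proof. by rewrite mxE unlock. Qed.

(** Coordinate i of (P^k F(., v))(x) - Fbar(v); k = 0 gives F - Fbar itself. *)
Definition resid (k : nat) (i : 'I_d) (x : S) v : R :=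
  iter k (kop P) (fun y => F y v ord0 i) x - mean_field mu F v ord0 i.

Lemma Crho_ge0 k : 0 <= C * rho ^+ k.
Proof.
have [C1 /andP[r0 _] _ _ _] := herg.
by rewrite mulr_ge0 ?exprn_ge0 ?(ltW r0)// (le_trans ler01).
Qed.

Lemma resid_bound k i x v :
  `|resid k i x v| <= 3 * (L1 * (enorm v + 1)) * (C * rho ^+ k).
Proof.
have [_ _ _ _ hk] := herg; have [L10 _ _ _] := hF.
rewrite /resid mean_fieldE; apply: iter_kop_mean_dist => //.
- exact: bmeas_operator.
- by rewrite mulr_ge0 ?(ltW L10)// addr_ge0// enorm_ge0.
- exact: operator_bound.
Qed.

(** The difference is the residual of F(., u) - F(., v), a function bounded by L1 |u - v|. The
    Lipschitz constant thus inherits rho^k, so that increments can later be summed over k. *)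
Lemma resid_lipschitz k i x u v :
  `|resid k i x u - resid k i x v| <= 3 * (L1 * enorm (u - v)) * (C * rho ^+ k).
Proof.
have [_ _ _ _ hk] := herg; have [L10 _ lF _] := hF.
have mu1 : (mu setT <= 1)%E by rewrite probability_setT.
have [bu bv] := (bmeas_operator u i, bmeas_operator v i).
have [ID IZ _] := bounded_functional_iter_kop P k x.
have -> : resid k i x u - resid k i x v =
    iter k (kop P) (fun y => F y u ord0 i + (-1) * F y v ord0 i) x
     - \int[mu]_y (F y u ord0 i + (-1) * F y v ord0 i).
  rewrite ID ?IZ ?(meanD mu1) ?(meanZ mu1)//; last 2 first.
  - exact: bmeasZ.
  - exact: bmeasZ.
  by rewrite /resid !mean_fieldE; ring.
apply: iter_kop_mean_dist => //.
- exact/bmeasD/bmeasZ.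
- by rewrite mulr_ge0 ?(ltW L10)// enorm_ge0.
- move=> y; have -> : F y u ord0 i + (-1) * F y v ord0 i = (F y u - F y v) ord0 i.
    by rewrite !mxE mulN1r.
  exact: le_trans (coord_le_enorm _ _) (lF _ _ _).
Qed.

(** The function u_k(x, v); k counts applications of the kernel, not time. *)
Definition bias ts (k : nat) (x : S) v : R :=
  \sum_(i < d) (v - ts) ord0 i * resid k i x v.

Lemma bmeas_resid k i v : bmeas setT (fun x => resid k i x v).
Proof.
apply: bmeasB; last exact: bmeas_cst.
by apply: bmeas_iter_kop; exact: bmeas_operator.
Qed.

Lemma bmeas_bias ts k v : bmeas setT (fun x => bias ts k x v).
Proof. by apply: bmeas_sum => i; apply: bmeasZ; exact: bmeas_resid. Qed.

(** The mean-field part is constant in the state and the kernel has mass one, so averaging only adds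
    one iteration. *)
Lemma kop_bias ts k v x : kop P (fun y => bias ts k y v) x = bias ts k.+1 x v.
Proof.
have P1 : (P x setT <= 1)%E by rewrite prob_kernel.
rewrite /kop /bias (mean_sum P1)//; last first.
  by move=> i; apply: bmeasZ; exact: bmeas_resid.
apply: eq_bigr => i _; rewrite (meanZ P1)//; last exact: bmeas_resid.
congr (_ * _); rewrite /resid (meanB P1)//; last 2 first.
- by apply: bmeas_iter_kop; exact: bmeas_operator.
- exact: bmeas_cst.
by rewrite Rintegral_cst// prob_kernel mulr1.
Qed.

Lemma bias_bound ts k x v : `|bias ts k x v| <=
  l1norm (v - ts) * (3 * (L1 * (enorm v + 1)) * (C * rho ^+ k)).
Proof.
rewrite /bias (le_trans (ler_norm_sum _ _ _))// mulr_suml.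
by apply: ler_sum => i _; rewrite normrM ler_wpM2l// resid_bound.
Qed.

(** The two factors of each product are changed one at a time, which explains the asymmetry in u and
    v. *)
Lemma bias_lipschitz ts k x u v : `|bias ts k x u - bias ts k x v| <=
  3 * L1 * (C * rho ^+ k) * l1norm (u - v) * (enorm u + 1 + l1norm (v - ts)).
Proof.
have [L10 _ _ _] := hF.
rewrite /bias -sumrB.
have -> : \sum_(i < d) ((u - ts) ord0 i * resid k i x u - (v - ts) ord0 i * resid k i x v)
   = \sum_(i < d) ((u - v) ord0 i * resid k i x u +
        (v - ts) ord0 i * (resid k i x u - resid k i x v)).
  by apply: eq_bigr => i _; rewrite !mxE; ring.
rewrite big_split/= (le_trans (ler_normD _ _))//.
rewrite mulrDr; apply: lerD.
  rewrite (le_trans (ler_norm_sum _ _ _))//.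
  apply: (@le_trans _ _ (l1norm (u - v) * (3 * (L1 * (enorm u + 1)) * (C * rho ^+ k)))).
    rewrite mulr_suml; apply: ler_sum => i _.
    by rewrite normrM ler_wpM2l// resid_bound.
  by rewrite le_eqVlt; apply/orP; left; apply/eqP; ring.
rewrite (le_trans (ler_norm_sum _ _ _))//.
apply: (@le_trans _ _ (l1norm (v - ts) * (3 * (L1 * l1norm (u - v)) * (C * rho ^+ k)))).
  rewrite mulr_suml; apply: ler_sum => i _.
  rewrite normrM ler_wpM2l// (le_trans (resid_lipschitz _ _ _ _ _))//.
  by rewrite ler_wpM2r ?Crho_ge0// ler_wpM2l// ler_wpM2l ?(ltW L10)// enorm_le_l1norm.
by rewrite le_eqVlt; apply/orP; left; apply/eqP; ring.
Qed.

Lemma ball_lipschitz_bias (T : Type) (D : set T) (X : T -> S) ts k M :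
  exists2 Lam : R, 0 <= Lam & forall t u v, D t -> l1norm u <= M -> l1norm v <= M ->
    `|bias ts k (X t) u - bias ts k (X t) v| <= Lam * l1norm (u - v).
Proof.
have [L10 _ _ _] := hF.
have H0 : 0 <= 3 * L1 * (C * rho ^+ k) by rewrite mulr_ge0 ?Crho_ge0// mulr_ge0 ?(ltW L10).
exists (3 * L1 * (C * rho ^+ k) * (`|M| + 1 + (`|M| + l1norm ts))).
  by rewrite mulr_ge0// !addr_ge0// l1norm_ge0.
move=> t u v _ uM vM; rewrite (le_trans (bias_lipschitz _ _ _ _ _))//.
rewrite -!mulrA ler_wpM2l// ler_wpM2l ?(ltW L10)// ler_wpM2l ?(le_trans ler01)//.
- by have [] := herg.
have [_ /andP[r0 _] _ _ _] := herg.
rewrite ler_wpM2l ?exprn_ge0 ?(ltW r0)// mulrC ler_wpM2r ?l1norm_ge0//.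
have hM := ler_norm M.
apply: lerD; first by rewrite lerD2r (le_trans (enorm_le_l1norm _))// (le_trans uM).
rewrite (le_trans (l1normD _ _))// lerD//; first exact: le_trans vM _.
by rewrite -(sub0r ts) l1normB subr0.
Qed.

End residual.

(** Moves conditional-expectation identities, stated on events A of the filtration, to the full
    event D, which is not known to belong to the filtration. *)
Lemma mean_full_measure {dO : measure_display} {Omega : measurableType dO}
    {R : realType} (Pr : probability Omega R) (D A : set Omega) (g : Omega -> R) :
  measurable D -> Pr (~` D) = 0%E -> measurable A ->
  Pr.-integrable setT (EFin \o g) ->
  \int[Pr]_(x in D) (\1_A x * g x) = \int[Pr]_(x in A) g x.
Proof.
move=> mD D0 mA ig.
have -> : \int[Pr]_(x in A) g x = \int[Pr]_(x in D `&` A) g x.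
  rewrite /Rintegral (@negligible_integral _ _ _ _ _ (~` D))//.
  - by rewrite setDE setCK setIC.
  - exact: measurableC.
  - exact: integrableS ig.
rewrite Rintegral_mkcondr; apply: eq_Rintegral => x _.
by rewrite patchE indicE; case: ifP => _; rewrite ?mul1r ?mul0r.
Qed.

(** * Mean estimates along the iterates *)

Section process.
Context {R : realType} {dS : measure_display} {S : measurableType dS} {d : nat}.
Context (P : R.-pker S ~> S) (mu : probability S R) (F : S -> 'rV[R]_d -> 'rV[R]_d).
Context (L1 L2 c0 C rho : R) (theta0 ts : 'rV[R]_d).
Context (hF : lipschitz_operator F L1) (herg : uniformly_ergodic P mu C rho).
Context (hdis : dissipative mu F ts c0) (L2_gt0 : 0 < L2).
Context {dO : measure_display} {Omega : measurableType dO}.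
Context (Pr : probability Omega R) (X : nat -> Omega -> S).
Context (w : nat -> Omega -> 'rV[R]_d) (al : nat -> R).
Context (al01 : forall k, 0 < al k <= 1).

Local Notation theta := (sa_iterates F al X w theta0).
Local Notation Fk := (sa_filtration theta X w).

Context (hmarkov : markov_chain Pr P X Fk) (hnoise : noise_condition Pr theta w Fk L2).
(* The noise is bounded almost surely only; D is an event of probability one on
   which all the bounds hold at once. *)
Context (D : set Omega) (mD : measurable D) (D0 : Pr (~` D) = 0%E).
Context (hw : forall k x, D x -> enorm (w k x) <= L2 * (enorm (theta k x) + 1)).

Let L1_gt0 : 0 < L1. Proof. by have [] := hF. Qed.
Let L_gt0 : 0 < L1 + L2. Proof. exact: addr_gt0. Qed.
Let al_gt0 k : 0 < al k. Proof. by have /andP[] := al01 k. Qed.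
Let al_le1 k : al k <= 1. Proof. by have /andP[] := al01 k. Qed.
Let PrD : (Pr D <= 1)%E. Proof. exact: probability_le1. Qed.

Lemma PrD1 : Pr D = 1%E.
Proof.
have := probability_setC Pr (measurableC mD).
by rewrite setCK D0 sube0.
Qed.

(** F is assumed measurable in the state for each fixed parameter only; joint behaviour comes from
    its Lipschitz bound through [measurable_caratheodory]. *)
Lemma measurable_theta k : measurable_fun setT (theta k).
Proof.
have [mX _] := hmarkov; have [mw _ _] := hnoise; have [_ _ lF _] := hF.
elim: k => [|k IH] /=; first exact: measurable_cst.
apply/measurable_rowP => i; under eq_fun do rewrite !mxE.
apply: measurable_funD; first exact: (measurable_rowP _).1 IH i.
apply: measurable_funM; first exact: measurable_cst.
apply: measurable_funD; last exact: (measurable_rowP _).1 (mw k) i.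
apply: (@measurable_caratheodory _ _ _ _ setT (fun x v => F (X k x) v ord0 i)) => //.
  move=> v; have [mf _] := bmeas_operator hF v i.
  exact: measurableT_comp mf (mX k).
move=> M; exists L1; first exact: ltW.
move=> x u v _ _ _.
have -> : F (X k x) u ord0 i - F (X k x) v ord0 i = (F (X k x) u - F (X k x) v) ord0 i.
  by rewrite !mxE.
rewrite (le_trans (coord_le_enorm _ _))// (le_trans (lF _ _ _))//.
by rewrite ler_wpM2l ?(ltW L1_gt0)// enorm_le_l1norm.
Qed.

Lemma step_bound k x : D x -> l1norm (theta k.+1 x - theta k x) <=
  al k * (d%:R * ((L1 + L2) * (enorm (theta k x) + 1))).
Proof.
move=> Dx.
apply: (@le_trans _ _ (\sum_(i < d) al k * ((L1 + L2) * (enorm (theta k x) + 1)))).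
  apply: ler_sum => i _; rewrite /= !mxE [X in `|X|](_ : _ =
    al k * (F (X k x) (theta k x) ord0 i + w k x ord0 i)); last by ring.
  rewrite normrM gtr0_norm// ler_wpM2l ?(ltW (al_gt0 k))//.
  rewrite (le_trans (ler_normD _ _))// mulrDl lerD ?operator_bound//.
  exact: le_trans (coord_le_enorm _ _) (hw _ _).
by rewrite sumr_const card_ord -mulrnAr -mulr_natl.
Qed.

(** The bound may grow with k. It serves integrability and freezing only; no rate depends on its
    size. *)
Lemma theta_bounded k : exists M, forall x, D x -> l1norm (theta k x) <= M.
Proof.
elim: k => [|k [M hM]]; first by exists (l1norm theta0).
exists (1 * (d%:R * ((L1 + L2) * (M + 1))) + M) => x Dx.
rewrite -[theta k.+1 x](subrK (theta k x)) (le_trans (l1normD _ _))// lerD ?hM//.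
rewrite (le_trans (step_bound _ Dx))// ler_pM ?(ltW (al_gt0 k))//.
  by rewrite mulr_ge0// mulr_ge0 ?(ltW L_gt0)// addr_ge0// enorm_ge0.
rewrite ler_wpM2l// ler_wpM2l ?(ltW L_gt0)// lerD2r.
exact: le_trans (enorm_le_l1norm _) (hM _ Dx).
Qed.

Lemma bmeas_theta k i : bmeas D (fun x => theta k x ord0 i).
Proof.
split.
  by apply: measurable_funTS; exact: (measurable_rowP _).1 (measurable_theta k) i.
have [M hM] := theta_bounded k; exists M => x Dx.
exact: le_trans (coord_le_l1norm _ _) (hM _ Dx).
Qed.

Lemma bmeas_noise k i : bmeas D (fun x => w k x ord0 i).
Proof.
have [mw _ _] := hnoise; split.
  by apply: measurable_funTS; exact: (measurable_rowP _).1 (mw k) i.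
have [M hM] := theta_bounded k; exists (L2 * (M + 1)) => x Dx.
rewrite (le_trans (coord_le_enorm _ _))// (le_trans (hw _ Dx))//.
rewrite ler_wpM2l ?(ltW L2_gt0)// lerD2r.
exact: le_trans (enorm_le_l1norm _) (hM _ Dx).
Qed.

Lemma bmeas_sqdist k : bmeas D (fun x => enorm (theta k x - ts) ^+ 2).
Proof.
under eq_fun do rewrite sqr_enorm.
apply: bmeas_sum => i; have bi : bmeas D (fun x => (theta k x - ts) ord0 i).
  under eq_fun do rewrite !mxE.
  by apply: bmeasB; [exact: bmeas_theta|exact: bmeas_cst].
exact: bmeasM.
Qed.

Lemma filtration_theta k B : measurable B -> Fk k (theta k @^-1` B).
Proof.
move=> mB; apply: sub_sigma_algebra; left; exists k => /=; first by [].
by left; exists B => //; rewrite setTI.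
Qed.

Lemma theta_preimage k B : measurable B -> measurable (theta k @^-1` B).
Proof. by move=> mB; rewrite -[X in measurable X]setTI; exact: measurable_theta. Qed.

(** Both sides are bounded functionals of f. They agree on indicators by the Markov hypothesis on
    the event theta_k in B, so [functional_dist] with t = 0 makes them equal. *)
Lemma markov_mean k (B : set ('rV[R]_d)) (f : S -> R) : measurable B -> bmeas setT f ->
  \int[Pr]_(x in D) (\1_(theta k @^-1` B) x * f (X k.+1 x)) =
  \int[Pr]_(x in D) (\1_(theta k @^-1` B) x * kop P f (X k x)).
Proof.
move=> mB bf; have [mX hX] := hmarkov.
have mA := theta_preimage k mB; set A := _ @^-1` B in mA *.
have bcomp j g : bmeas setT g -> bmeas D (fun x => \1_A x * g (X j x)).
  move=> bg; apply: bmeasM; first exact: bmeas_indic.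
  exact: bmeas_comp.
have func j (G : (S -> R) -> S -> R) :
    (forall g h, bmeas setT g -> bmeas setT h ->
       G (fun x => g x + h x) = fun x => G g x + G h x) ->
    (forall c g, bmeas setT g -> G (fun x => c * g x) = fun x => c * G g x) ->
    (forall g, bmeas setT g -> bmeas setT (G g)) ->
    (forall g (M : R), bmeas setT g -> 0 <= M -> (forall x, `|g x| <= M) ->
       forall x, `|G g x| <= M) ->
    bounded_functional (fun g => \int[Pr]_(x in D) (\1_A x * G g (X j x))).
  move=> GD GZ Gb GM; split=> [g h bg bh|c g bg|g M bg M0 hM].
  - rewrite GD//; under eq_Rintegral do rewrite mulrDr.
    by rewrite (meanD PrD)//; exact/bcomp/Gb.
  - rewrite GZ//; under eq_Rintegral do rewrite mulrCA.
    by rewrite (meanZ PrD)//; exact/bcomp/Gb.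
  - apply: (mean_bound PrD) => //; first exact/bcomp/Gb.
    move=> x _; rewrite normrM -[leRHS]mul1r ler_pM//; last exact: GM.
    by rewrite indicE normr_nat lern1 leq_b1.
have [mf [M hM]] := bf.
apply/eqP; rewrite -subr_eq0 -normr_le0.
rewrite -[leRHS](mulr0 (3 * `|M|)).
apply: (functional_dist (func k.+1 id _ _ _ _) (func k (kop P) _ _ _ _)) => //.
- exact: kopD.
- by move=> c g; exact: kopZ.
- exact: bmeas_kop.
- by move=> g N; exact: kop_bound.
- move=> E mE; rewrite normr_le0 subr_eq0; apply/eqP.
  have [i1 i2 _ h] := hX k E mE.
  have e1 := mean_full_measure mD D0 mA i1.
  have e2 := mean_full_measure mD D0 mA i2.
  have := h A (@filtration_theta k B mB); move/(congr1 fine).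
  rewrite -/(Rintegral Pr A _) -/(Rintegral Pr A _) -e1 -e2 => e.
  transitivity (\int[Pr]_(x in D) (\1_A x * \1_(X k.+1 @^-1` E) x)).
    by apply: eq_Rintegral => x _; congr (_ * _); rewrite !indicE.
  rewrite e; apply: eq_Rintegral => x _; congr (_ * _).
  by rewrite /kop /Rintegral integral_indic// setIT.
- by move=> x; rewrite (le_trans (hM x I))// ler_norm.
Qed.

Lemma bmeas_bias_at j n v : bmeas D (fun x => bias P mu F ts n (X j x) v).
Proof.
have [mX _] := hmarkov; exact: (bmeas_comp (mX j) (bmeas_bias P mu hF ts n v) mD).
Qed.

Lemma ball_lipschitz_bias_at j n :
  ball_lipschitz D (fun x v => bias P mu F ts n (X j x) v).
Proof. by move=> K; exact: (ball_lipschitz_bias hF herg). Qed.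

Lemma bmeas_bias_process k j n : bmeas D (fun x => bias P mu F ts n (X j x) (theta k x)).
Proof.
have [M hM] := theta_bounded k.
exact: (bmeas_freeze mD (measurable_theta k) (bmeas_bias_at j n)
  (ball_lipschitz_bias_at j n) hM).
Qed.

(** With theta_k frozen, passing from X_k to X_(k+1) is one kernel average, and [kop_bias] turns it
    into the index n + 1. *)
Lemma markov_bias k n :
  \int[Pr]_(x in D) bias P mu F ts n (X k.+1 x) (theta k x) =
  \int[Pr]_(x in D) bias P mu F ts n.+1 (X k x) (theta k x).
Proof.
have [M hM] := theta_bounded k.
apply: (freezing PrD mD (measurable_theta k) (bmeas_bias_at k.+1 n)
  (bmeas_bias_at k n.+1) (ball_lipschitz_bias_at k.+1 n)
  (ball_lipschitz_bias_at k n.+1) hM) => v B mB.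
rewrite (markov_mean k mB (bmeas_bias P mu hF ts n v)).
by apply: eq_Rintegral => x _; rewrite (kop_bias P mu hF).
Qed.

(** theta_k is known at time k and the noise has conditional mean 0: [freezing] is applied against
    the zero function. *)
Lemma noise_orthogonal k :
  \int[Pr]_(x in D) (\sum_(i < d) (theta k x - ts) ord0 i * w k x ord0 i) = 0.
Proof.
have [mw cw _] := hnoise; have [M hM] := theta_bounded k.
have bPhi v : bmeas D (fun x => \sum_(i < d) (v - ts) ord0 i * w k x ord0 i).
  by apply: bmeas_sum => i; apply: bmeasZ; exact: bmeas_noise.
have M0 x : D x -> 0 <= M by move=> /hM; apply: le_trans; exact: l1norm_ge0.
have lPhi : ball_lipschitz D
    (fun x v => \sum_(i < d) (v - ts) ord0 i * w k x ord0 i).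
  move=> K; exists (L2 * (`|M| + 1)); first by rewrite mulr_ge0 ?(ltW L2_gt0)// addr_ge0.
  move=> x u v Dx uK vK; rewrite -sumrB mulrC /l1norm mulr_suml.
  rewrite (le_trans (ler_norm_sum _ _ _))//; apply: ler_sum => i _.
  rewrite [X in `|X|](_ : _ = (u - v) ord0 i * w k x ord0 i); last by rewrite !mxE; ring.
  rewrite normrM ler_wpM2l// (le_trans (coord_le_enorm _ _))// (le_trans (hw _ Dx))//.
  rewrite ler_wpM2l ?(ltW L2_gt0)// lerD2r (le_trans (enorm_le_l1norm _))//.
  by rewrite (le_trans (hM _ Dx))// ler_norm.
have l0 : ball_lipschitz D (fun _ (_ : 'rV[R]_d) => 0 : R).
  by move=> K; exists 0 => // x u v' _ _ _; rewrite subrr normr0 mul0r.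
rewrite (freezing PrD mD (measurable_theta k) bPhi (fun=> bmeas_cst D 0) lPhi l0 hM).
  exact: mean0.
move=> v B mB.
have mA := theta_preimage k mB; set A := _ @^-1` B in mA *.
transitivity (\int[Pr]_(x in D) (\sum_(i < d) (v - ts) ord0 i * (\1_A x * w k x ord0 i))).
  apply: eq_Rintegral => x _; rewrite mulr_sumr; apply: eq_bigr => i _.
  by rewrite mulrCA.
have bi i : bmeas D (fun x => \1_A x * w k x ord0 i).
  by apply: bmeasM; [exact: bmeas_indic|exact: bmeas_noise].
rewrite (mean_sum PrD)//; last by move=> i; apply: bmeasZ.
rewrite big1; last first.
  move=> i _; rewrite (meanZ PrD)//.
  have [i1 i2 _ h] := cw k i.
  rewrite (mean_full_measure mD D0 mA i1).
  rewrite /Rintegral (h A (@filtration_theta k B mB)) integral0 //= mulr0//.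
by under eq_Rintegral do rewrite mulr0; rewrite mean0.
Qed.

(** With e = |v - theta*|, [kap] (1 + e) dominates each linear quantity in v met below. [kap2] does
    the same for the last factor of [bias_lipschitz] when u is the next iterate: d (L1 + L2) for the
    step, 2 for the two terms at v. *)
Let kap : R := d%:R + 1 + l1norm ts.
Let kap2 : R := (d%:R * (L1 + L2) + 2) * kap.

Let kap_ge0 : 0 <= kap.
Proof. by rewrite !addr_ge0// l1norm_ge0. Qed.

Let kap2_ge0 : 0 <= kap2.
Proof. by rewrite mulr_ge0// addr_ge0// mulr_ge0// ltW. Qed.

Let C_ge0 : 0 <= C.
Proof. by have [C1 _ _ _ _] := herg; exact: le_trans C1. Qed.

Let rho_ge0 n : 0 <= rho ^+ n.
Proof. by have [_ /andP[r0 _] _ _ _] := herg; rewrite exprn_ge0// ltW. Qed.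

Lemma l1norm_sub_le v : l1norm (v - ts) <= kap * (1 + enorm (v - ts)).
Proof.
apply: (le_trans (l1norm_le_enorm _)); rewrite ler_pM ?enorm_ge0//.
  by rewrite /kap -addrA lerDl addr_ge0// l1norm_ge0.
by rewrite lerDr.
Qed.

Lemma l1norm_add1_le v : l1norm v + 1 <= kap * (1 + enorm (v - ts)).
Proof.
have h1 := l1norm_le_enorm (v - ts); have h2 := l1normD (v - ts) ts.
rewrite subrK in h2; have e0 := enorm_ge0 (v - ts); have t0 := l1norm_ge0 ts.
have := mulr_ge0 t0 e0; have d0 : 0 <= d%:R :> R by [].
rewrite /kap; nra.
Qed.

Lemma enorm_add1_le v : enorm v + 1 <= kap * (1 + enorm (v - ts)).
Proof.
by rewrite (le_trans _ (l1norm_add1_le v))// lerD2r enorm_le_l1norm.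
Qed.

Lemma sqr_add1_le (e : R) : (1 + e) * (1 + e) <= 2 * (1 + e ^+ 2).
Proof. by have := sqr_ge0 (1 - e); rewrite !expr2; nra. Qed.

(** Brings quadratic bounds to multiples of 1 + e^2, whose mean is 1 + V; the trailing factors 2 in
    the constants originate here. *)
Lemma le_of_sqr_add1 (K x y e : R) : 0 <= K -> 0 <= e ->
  y <= K * ((1 + e) * (1 + e)) -> x <= y -> x <= K * 2 * (1 + e ^+ 2).
Proof.
move=> K0 e0 h1 h2; rewrite (le_trans h2)// (le_trans h1)// -mulrA ler_wpM2l//.
exact: sqr_add1_le.
Qed.

Lemma bias_quadratic n x v : `|bias P mu F ts n x v| <=
  3 * L1 * C * kap ^+ 2 * rho ^+ n * 2 * (1 + enorm (v - ts) ^+ 2).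
Proof.
have [L10 e0] := (ltW L1_gt0, enorm_ge0 (v - ts)).
apply: (le_of_sqr_add1 _ e0 _ (bias_bound hF herg ts n x v)).
  by rewrite !mulr_ge0// exprn_ge0.
apply: (@le_trans _ _ (kap * (1 + enorm (v - ts)) *
    (3 * (L1 * (kap * (1 + enorm (v - ts)))) * (C * rho ^+ n)))); last first.
  by rewrite le_eqVlt; apply/orP; left; apply/eqP; ring.
rewrite ler_pM ?l1norm_ge0 ?l1norm_sub_le//.
  by rewrite !mulr_ge0// addr_ge0// enorm_ge0.
rewrite ler_wpM2r ?mulr_ge0// ler_wpM2l// ler_wpM2l//.
exact: enorm_add1_le.
Qed.

(** The state is the same on both sides; only the parameter moves, by O(al_k), and the Lipschitz
    constant carries rho^n. *)
Lemma bias_step n k x : D x ->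
  `|bias P mu F ts n (X k.+1 x) (theta k.+1 x) - bias P mu F ts n (X k.+1 x) (theta k x)| <=
  3 * L1 * C * rho ^+ n * al k * d%:R * (L1 + L2) * kap * kap2 * 2
    * (1 + enorm (theta k x - ts) ^+ 2).
Proof.
move=> Dx; have L10 := ltW L1_gt0; have L0 := ltW L_gt0; have a0 := ltW (al_gt0 k).
set v := theta k x; have e0 := enorm_ge0 (v - ts).
have [h1 h2] := (l1norm_sub_le v, enorm_add1_le v).
have hstep : l1norm (theta k.+1 x - v) <= d%:R * ((L1 + L2) * (kap * (1 + enorm (v - ts)))) * al k.
  rewrite (le_trans (step_bound k Dx))// mulrC ler_wpM2r// ler_wpM2l// ler_wpM2l//.
apply: (le_of_sqr_add1 _ e0 _ (bias_lipschitz hF herg ts n (X k.+1 x) (theta k.+1 x) v)).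
  by rewrite (mulr_ge0 _ kap2_ge0)// !mulr_ge0.
apply: (@le_trans _ _ (3 * L1 * (C * rho ^+ n) *
   (d%:R * ((L1 + L2) * (kap * (1 + enorm (v - ts)))) * al k) *
   (kap2 * (1 + enorm (v - ts))))); last first.
  by rewrite le_eqVlt; apply/orP; left; apply/eqP; ring.
rewrite -!(mulrA (3 * L1 * (C * rho ^+ n))) ler_wpM2l ?mulr_ge0//.
rewrite ler_pM ?l1norm_ge0//; first by rewrite addr_ge0 ?l1norm_ge0// addr_ge0// enorm_ge0.
have h3 : enorm (theta k.+1 x) <= l1norm (theta k.+1 x - v) + l1norm v.
  rewrite (le_trans (enorm_le_l1norm _))// -[X in l1norm X <= _](subrK v).
  exact: l1normD.
have h4 : l1norm (theta k.+1 x - v) <= d%:R * ((L1 + L2) * (kap * (1 + enorm (v - ts)))).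
  rewrite (le_trans hstep)// ler_piMr//.
  by rewrite !mulr_ge0// addr_ge0.
have h5 := l1norm_add1_le v.
rewrite /kap2; lra.
Qed.

(** In the expanded square, F in the cross term splits into the mean field, handled by
    dissipativity, and F - Fbar, which is [bias] at 0. The noise term is kept because its mean
    vanishes. *)
Lemma sqdist_step k x : D x ->
  enorm (theta k.+1 x - ts) ^+ 2 <=
    (1 - 2 * c0 * al k) * enorm (theta k x - ts) ^+ 2
    + 2 * al k * bias P mu F ts 0 (X k x) (theta k x)
    + 2 * al k * (\sum_(i < d) (theta k x - ts) ord0 i * w k x ord0 i)
    + d%:R * (L1 + L2) ^+ 2 * kap ^+ 2 * 2 * al k ^+ 2 * (1 + enorm (theta k x - ts) ^+ 2).
Proof.
move=> Dx; set v := theta k x; have a0 := ltW (al_gt0 k).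
have -> : enorm (theta k.+1 x - ts) ^+ 2 = enorm (v - ts) ^+ 2 +
    2 * al k * dot (v - ts) (mean_field mu F v) +
    2 * al k * bias P mu F ts 0 (X k x) v +
    2 * al k * (\sum_(i < d) (v - ts) ord0 i * w k x ord0 i) +
    al k ^+ 2 * \sum_(i < d) (F (X k x) v ord0 i + w k x ord0 i) ^+ 2.
  rewrite !sqr_enorm /dot /bias !mulr_sumr -!big_split; apply: eq_bigr => i _ /=.
  by rewrite /resid /= -/v !mxE; ring.
have [_ _ _ hd] := hdis; have := ler_wpM2l (mulr_ge0 (ler0n R 2) a0) (hd v).
have e0 := enorm_ge0 (v - ts).
have : \sum_(i < d) (F (X k x) v ord0 i + w k x ord0 i) ^+ 2 <=
    d%:R * (L1 + L2) ^+ 2 * kap ^+ 2 * 2 * (1 + enorm (v - ts) ^+ 2).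
  apply: (le_of_sqr_add1 _ e0 _ (lexx _)); first by rewrite !mulr_ge0// ltW.
  apply: (@le_trans _ _ (\sum_(i < d) ((L1 + L2) * (kap * (1 + enorm (v - ts)))) ^+ 2)).
    apply: ler_sum => i _; rewrite -[leLHS]real_normK ?num_real//.
    rewrite lerXn2r ?nnegrE//; first by rewrite mulr_ge0 ?(ltW L_gt0)// mulr_ge0// addr_ge0.
    apply: (@le_trans _ _ ((L1 + L2) * (enorm v + 1))).
      rewrite (le_trans (ler_normD _ _))// mulrDl lerD ?operator_bound//.
      exact: le_trans (coord_le_enorm _ _) (hw _ _).
    by rewrite ler_wpM2l ?(ltW L_gt0)// enorm_add1_le.
  rewrite sumr_const card_ord -mulr_natl.
  by rewrite le_eqVlt; apply/orP; left; apply/eqP; ring.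
move/(ler_wpM2l (sqr_ge0 (al k))).
set A := al k ^+ 2 * \sum_(_ < _) _; set B := 2 * al k * dot _ _.
move=> hA hB.
have {}hA : A <= d%:R * (L1 + L2) ^+ 2 * kap ^+ 2 * 2 * al k ^+ 2 * (1 + enorm (v - ts) ^+ 2).
  by rewrite (le_trans hA)// le_eqVlt; apply/orP; left; apply/eqP; ring.
lra.
Qed.

(** The constants of [bias_quadratic], [bias_step] and [sqdist_step] added up, so that one number
    serves all three mean estimates. No stepsize enters, hence no h. *)
Definition drift_const : R :=
  3 * L1 * C * kap ^+ 2 * 2 +
  3 * L1 * C * d%:R * (L1 + L2) * kap * kap2 * 2 +
  d%:R * (L1 + L2) ^+ 2 * kap ^+ 2 * 2.

Local Notation V k := (\int[Pr]_(x in D) enorm (theta k x - ts) ^+ 2).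
Local Notation b k n := (\int[Pr]_(x in D) bias P mu F ts n (X k x) (theta k x)).

Let term1_ge0 : 0 <= 3 * L1 * C * kap ^+ 2 * 2.
Proof. by rewrite !mulr_ge0// ltW. Qed.
Let term2_ge0 : 0 <= 3 * L1 * C * d%:R * (L1 + L2) * kap * kap2 * 2.
Proof. by rewrite mulr_ge0// (mulr_ge0 _ kap2_ge0)// !mulr_ge0// ltW. Qed.
Let term3_ge0 : 0 <= d%:R * (L1 + L2) ^+ 2 * kap ^+ 2 * 2.
Proof. by rewrite !mulr_ge0// ltW. Qed.

Lemma drift_const_ge0 : 0 <= drift_const.
Proof. by rewrite !addr_ge0. Qed.

Let V_ge0 k : 0 <= V k.
Proof. by apply: Rintegral_ge0 => x _; rewrite exprn_ge0// enorm_ge0. Qed.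

Let mean_1DV k c : \int[Pr]_(x in D) (c * (1 + enorm (theta k x - ts) ^+ 2)) = c * (1 + V k).
Proof.
have bV := bmeas_sqdist k; have b1 := bmeas_cst D (1 : R).
rewrite (meanZ PrD)//; last exact: bmeasD.
rewrite (meanD PrD)//; congr (_ * (_ + _)).
by rewrite Rintegral_cst// mul1r; exact: (congr1 fine PrD1).
Qed.

Let bmeas_1DV k c : bmeas D (fun x => c * (1 + enorm (theta k x - ts) ^+ 2)).
Proof. by apply/bmeasZ/bmeasD/bmeas_sqdist/bmeas_cst. Qed.

Lemma mean_bias_bound k n : `|b k n| <= drift_const * rho ^+ n * (1 + V k).
Proof.
apply: (@le_trans _ _ (\int[Pr]_(x in D)
   (drift_const * rho ^+ n * (1 + enorm (theta k x - ts) ^+ 2)))); last by rewrite mean_1DV.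
apply: (mean_norm PrD) => //; first exact: bmeas_bias_process.
move=> x Dx; rewrite (le_trans (bias_quadratic _ _ _))//.
rewrite ler_wpM2r ?addr_ge0 ?sqr_ge0//.
rewrite -mulrA (mulrC (rho ^+ n)) mulrA ler_wpM2r// /drift_const -addrA lerDl.
exact: addr_ge0.
Qed.

(** By [markov_bias], b_(k,n+1) is the mean of the bias at (X_(k+1), theta_k), so only the move of
    theta remains. *)
Lemma mean_bias_shift k n :
  `|b k.+1 n - b k n.+1| <= drift_const * rho ^+ n * al k * (1 + V k).
Proof.
rewrite -markov_bias -(meanB PrD)//; [|exact: bmeas_bias_process..].
apply: (@le_trans _ _ (\int[Pr]_(x in D)
   (drift_const * rho ^+ n * al k * (1 + enorm (theta k x - ts) ^+ 2)))); last by rewrite mean_1DV.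
apply: (mean_norm PrD) => //.
  by apply: bmeasB; exact: bmeas_bias_process.
move=> x Dx; rewrite (le_trans (bias_step _ _ Dx))//.
rewrite ler_wpM2r ?addr_ge0 ?sqr_ge0//.
apply: (@le_trans _ _ (3 * L1 * C * d%:R * (L1 + L2) * kap * kap2 * 2 * rho ^+ n * al k)).
  by rewrite le_eqVlt; apply/orP; left; apply/eqP; ring.
rewrite ler_wpM2r ?(ltW (al_gt0 k))// ler_wpM2r//.
by rewrite /drift_const -addrA addrC -addrA lerDl addr_ge0.
Qed.

Lemma mean_drift k : V k.+1 <=
  (1 - 2 * c0 * al k) * V k + 2 * al k * b k 0%N + drift_const * al k ^+ 2 * (1 + V k).
Proof.
have bw : bmeas D (fun x => \sum_(i < d) (theta k x - ts) ord0 i * w k x ord0 i).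
  apply: bmeas_sum => i; apply: bmeasM; last exact: bmeas_noise.
  under eq_fun do rewrite !mxE.
  by apply: bmeasB; [exact: bmeas_theta|exact: bmeas_cst].
have bV := bmeas_sqdist k; have bb := bmeas_bias_process k k 0.
set K := d%:R * (L1 + L2) ^+ 2 * kap ^+ 2 * 2 * al k ^+ 2.
have h1 := bmeasZ (1 - 2 * c0 * al k) bV.
have h2 := bmeasZ (2 * al k) bb.
have h3 := bmeasZ (2 * al k) bw.
have := mean_le PrD mD (bmeas_sqdist k.+1)
  (bmeasD (bmeasD (bmeasD h1 h2) h3) (bmeas_1DV k K)) (@sqdist_step k).
rewrite (meanD PrD mD (bmeasD (bmeasD h1 h2) h3))//.
rewrite (meanD PrD mD (bmeasD h1 h2))// (meanD PrD mD h1)// mean_1DV.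
rewrite !(meanZ PrD)// noise_orthogonal mulr0 addr0 => /le_trans; apply.
rewrite lerD2l ler_wpM2r ?addr_ge0// ler_wpM2r ?sqr_ge0//.
by rewrite /drift_const lerDr addr_ge0.
Qed.

Lemma mean_sqdistE k :
  ('E_Pr[fun x => (enorm (theta k x - ts) ^+ 2)%R] = (V k)%:E)%E.
Proof.
rewrite unlock -(meanE PrD mD (bmeas_sqdist k)).
have mN : measurable (~` D) by exact: measurableC.
rewrite (@ge0_negligible_integral _ _ _ _ setT (~` D))//.
- by rewrite setDE setCK setTI.
- apply/measurable_EFinP; under eq_fun do rewrite sqr_enorm.
  apply: measurable_sum => i; under eq_fun do rewrite !mxE.
  have mi := (measurable_rowP _).1 (measurable_theta k) i.
  by apply: measurable_funM; apply: measurable_funB => //; exact: measurable_cst.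
- by move=> x _; rewrite lee_fin sqr_ge0.
Qed.

End process.

(** * Summing the biases: the Poisson equation *)

Section poisson.
Context {R : realType}.
Context (V al : nat -> R) (b : nat -> nat -> R) (B rho : R).
Context (V_ge0 : forall k, 0 <= V k) (B_ge0 : 0 <= B) (rho01 : 0 < rho < 1).
Context (al_ge0 : forall k, 0 <= al k).
Context (b_bound : forall k n, `|b k n| <= B * rho ^+ n * (1 + V k)).
Context (b_shift : forall k n,
  `|b k.+1 n - b k n.+1| <= B * rho ^+ n * al k * (1 + V k)).

Lemma geometric_sum_bound (c : R) (u : nat -> R) N : 0 <= c ->
  (forall n, `|u n| <= c * rho ^+ n) -> `|series u N| <= c / (1 - rho).
Proof.
move=> c0 hu; have /andP[r0 r1] := rho01.
rewrite /series /= (le_trans (ler_norm_sum _ _ _))//.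
apply: (@le_trans _ _ (\sum_(0 <= n < N) c * rho ^+ n)); first exact: ler_sum.
rewrite -mulr_sumr ler_wpM2l// -[leRHS]mul1r ler_pdivlMr ?subr_gt0//.
rewrite mulrC big_mkord -[X in X <= _]opprK -mulNr opprB -subrX1 opprB.
by rewrite lerBlDr lerDl exprn_ge0// ltW.
Qed.

Lemma cvg_geometric_bound (c : R) (u : nat -> R) :
  (forall n, `|u n| <= c * rho ^+ n) -> cvgn (series u).
Proof.
move=> hu; have /andP[r0 r1] := rho01.
apply: normed_cvg; apply: (@series_le_cvg _ _ (geometric c rho)) => //.
- by move=> n /=.
- by move=> n; exact: le_trans (normr_ge0 _) (hu n).
- by apply: is_cvg_geometric_series; rewrite gtr0_norm.
Qed.

(* The solution sum_n (P^n f - mu f) of the Poisson equation, averaged along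
   the process: its increments reproduce b k 0 up to O(al k). *)
Lemma poisson_solution : exists g : nat -> R,
  (forall k, `|g k| <= B / (1 - rho) * (1 + V k)) /\
  (forall k, b k 0%N <= g k - g k.+1 + B / (1 - rho) * (al k * (1 + V k))).
Proof.
have /andP[r0 r1] := rho01.
have hb k n : `|b k n| <= (B * (1 + V k)) * rho ^+ n.
  by rewrite (le_trans (b_bound k n))// mulrAC.
have cb k : cvgn (series (b k)) by exact: cvg_geometric_bound (hb k).
exists (fun k => limn (series (b k))); split=> k.
  have h N : `|series (b k) N| <= B / (1 - rho) * (1 + V k).
    have := geometric_sum_bound N _ (hb k).
    by rewrite mulrAC; apply; rewrite mulr_ge0// addr_ge0.
  rewrite ler_norml; apply/andP; split.
    by apply: limr_ge => //; apply: nearW => N; have := h N; rewrite ler_norml => /andP[].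
  by apply: limr_le => //; apply: nearW => N; have := h N; rewrite ler_norml => /andP[].
have hs N : `|series (fun n => b k.+1 n - b k n.+1) N| <= B / (1 - rho) * (al k * (1 + V k)).
  have := @geometric_sum_bound (B * (al k * (1 + V k))) (fun n => b k.+1 n - b k n.+1) N.
  rewrite mulrAC; apply; first by rewrite mulr_ge0// mulr_ge0// addr_ge0.
  move=> n; rewrite (le_trans (b_shift k n))//.
  by rewrite le_eqVlt; apply/orP; left; apply/eqP; ring.
have c1 : series (b k) N.+1 @[N --> \oo] --> limn (series (b k)).
  by have := cb k; rewrite -cvg_shiftS.
have c2 : (series (b k.+1) N - series (b k) N.+1 + b k 0%N) @[N --> \oo] -->
    limn (series (b k.+1)) - limn (series (b k)) + b k 0%N.
  by apply: cvgD; [apply: cvgB => //; exact: cb|exact: cvg_cst].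
(* The shifted sum of b_(k,n+1) misses the term n = 0, which is the one to be isolated. *)
have e N : series (b k.+1) N - series (b k) N.+1 + b k 0%N =
   series (fun n => b k.+1 n - b k n.+1) N.
  rewrite /series /= sumrB big_nat_recl//=; ring.
have : limn (series (b k.+1)) - limn (series (b k)) + b k 0%N <=
    B / (1 - rho) * (al k * (1 + V k)).
  rewrite -(cvg_lim _ c2)//; apply: limr_le; first by apply/cvg_ex; eexists; exact: c2.
  by apply: nearW => N; rewrite e; have := hs N; rewrite ler_norml => /andP[].
lra.
Qed.

End poisson.

(** * The corrected Lyapunov recursion *)

Section lyapunov.
Context {R : realType}.
Context (V al g : nat -> R) (b : nat -> R) (B G A c0 : R).
Context (V_ge0 : forall k, 0 <= V k) (B_ge0 : 0 <= B) (G_ge0 : 0 <= G) (A_ge0 : 0 <= A).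
Context (c0_gt0 : 0 < c0) (al01 : forall k, 0 < al k <= 1).
Context (al_decr : forall k, 0 <= al k - al k.+1 <= A * al k ^+ 2).
Context (b_bound : forall k, b k <= B * (1 + V k)).
Context (drift : forall k,
  V k.+1 <= (1 - 2 * c0 * al k) * V k + 2 * al k * b k + B * al k ^+ 2 * (1 + V k)).
Context (g_bound : forall k, `|g k| <= G * (1 + V k)).
Context (g_poisson : forall k, b k <= g k - g k.+1 + G * (al k * (1 + V k))).

(** In order: the contraction acting on the correction 2 al_k g_k, the change of stepsize in front
    of g_(k+1), the Poisson remainder, and the drift remainder. *)
Definition lyap_const : R := 4 * c0 * G + 2 * A * G * (1 + 3 * B) + 2 * G + B.
Local Notation H := lyap_const.

Lemma lyap_const_ge0 : 0 <= H.
Proof.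
have := ltW c0_gt0; rewrite /lyap_const => c0_ge0.
by rewrite !addr_ge0// !mulr_ge0// addr_ge0// mulr_ge0.
Qed.

Let W k := V k + 2 * al k * g k.

(** Needed because g_(k+1) is controlled by V_(k+1). The bias contributes 2B and the quadratic term
    B. *)
Lemma growth k : 1 + V k.+1 <= (1 + 3 * B) * (1 + V k).
Proof.
have /andP[a0 a1] := al01 k; have V0 := V_ge0 k.
have h1 : 2 * c0 * al k * V k >= 0 by rewrite !mulr_ge0// ltW.
have h2 : 2 * al k * b k <= 2 * (B * (1 + V k)).
  rewrite -mulrA ler_wpM2l// (le_trans (ler_wpM2l (ltW a0) (b_bound k)))//.
  by rewrite ler_piMl// mulr_ge0// addr_ge0.
have h3 : B * al k ^+ 2 * (1 + V k) <= B * (1 + V k).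
  rewrite ler_wpM2r ?addr_ge0// ler_piMr// exprn_ile1// ltW//.
have := drift k; lra.
Qed.

(** The Poisson bound yields -2 al_k g_(k+1) where W_(k+1) carries al_(k+1); the mismatch is
    O(al_k^2) by [al_decr]. *)
Lemma lyap_step k : W k.+1 <= (1 - 2 * c0 * al k) * W k + H * al k ^+ 2 * (1 + V k).
Proof.
have /andP[a0 a1] := al01 k; have V0 := V_ge0 k; have /andP[d0 d1] := al_decr k.
have V1 : 0 <= 1 + V k by rewrite addr_ge0.
have e1 : 2 * al k * b k <= 2 * al k * (g k - g k.+1 + G * (al k * (1 + V k))).
  by rewrite ler_wpM2l ?mulr_ge0 ?(ltW a0).
have e2 : 4 * c0 * al k ^+ 2 * g k <= 4 * c0 * al k ^+ 2 * (G * (1 + V k)).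
  rewrite ler_wpM2l//; last exact: le_trans (ler_norm _) (g_bound k).
  by rewrite !mulr_ge0 ?(ltW c0_gt0) ?(ltW a0).
have e3 : - (2 * (al k - al k.+1) * g k.+1) <=
    2 * (A * al k ^+ 2) * (G * ((1 + 3 * B) * (1 + V k))).
  rewrite (le_trans (ler_norm _))// normrN normrM ler_pM//.
    by rewrite ger0_norm ?ler_wpM2l// mulr_ge0.
  by rewrite (le_trans (g_bound _))// ler_wpM2l// growth.
apply: (@le_trans _ _ ((1 - 2 * c0 * al k) * V k +
    2 * al k * (g k - g k.+1 + G * (al k * (1 + V k))) +
    B * al k ^+ 2 * (1 + V k) + 2 * al k.+1 * g k.+1)).
  by rewrite /W lerD2r (le_trans (drift k))// lerD2r lerD2l.
rewrite -subr_ge0.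
rewrite [leRHS](_ : _ =
  (4 * c0 * al k ^+ 2 * (G * (1 + V k)) - 4 * c0 * al k ^+ 2 * g k) +
  (2 * (A * al k ^+ 2) * (G * ((1 + 3 * B) * (1 + V k))) +
   2 * (al k - al k.+1) * g k.+1)); last by rewrite /W /lyap_const; ring.
by apply: addr_ge0; lra.
Qed.

(** The correction 2 al_k g_k is then at most half of 1 + V_k. *)
Lemma V_le_lyap k : 4 * G * al k <= 1 -> 1 + V k <= 2 * (1 + W k).
Proof.
move=> hG; have /andP[a0 a1] := al01 k.
have : - (2 * al k * g k) <= 2 * al k * (G * (1 + V k)).
  rewrite -mulrN ler_wpM2l ?mulr_ge0 ?(ltW a0)//.
  by rewrite (le_trans (ler_norm _))// normrN g_bound.
have : (4 * G * al k) * (1 + V k) <= 1 * (1 + V k) by rewrite ler_wpM2r// addr_ge0.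
by rewrite /W; lra.
Qed.

Let U k := Num.max (W k) 0.

Lemma lyap_contraction k : 4 * G * al k <= 1 -> 2 * c0 * al k <= 1 ->
  2 * H * al k <= c0 ->
  U k.+1 <= (1 - c0 * al k) * U k + 2 * H * al k ^+ 2.
Proof.
move=> hG hc hH; have /andP[a0 a1] := al01 k; have H0 := lyap_const_ge0.
have s0 : 0 <= 2 * H * al k ^+ 2 by rewrite !mulr_ge0// ltW.
have hW : W k.+1 <= (1 - 2 * c0 * al k + 2 * H * al k ^+ 2) * W k + 2 * H * al k ^+ 2.
  have h := ler_wpM2l (mulr_ge0 H0 (sqr_ge0 (al k))) (V_le_lyap hG).
  have := lyap_step k; lra.
have U0 : 0 <= U k by rewrite le_max lexx orbT.
have ca : 0 < c0 * al k by rewrite mulr_gt0.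
rewrite ge_max; apply/andP; split; last first.
  by rewrite addr_ge0// mulr_ge0//; lra.
have [W0|W0] := leP 0 (W k).
  have -> : U k = W k by rewrite /U; apply/max_idPl.
  apply: (le_trans hW); rewrite lerD2r ler_wpM2r//.
  have : (2 * H * al k) * al k <= c0 * al k by rewrite ler_wpM2r// ltW.
  by rewrite -mulrA -expr2; lra.
apply: (le_trans hW); rewrite lerD2r; apply: (@le_trans _ _ 0).
  by rewrite mulr_ge0_le0 ?(ltW W0)//; lra.
by rewrite mulr_ge0//; lra.
Qed.

(** * Comparison with supersolutions *)

Section comparison.
Context (hG : forall k, 4 * G * al k <= 1) (hc : forall k, 2 * c0 * al k <= 1).
Context (hH : forall k, 2 * H * al k <= c0).
Context (hom N : nat -> R) (K : nat) (s beta : R).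
Context (hom1 : 1 <= hom K) (N0 : 0 <= N K).
Context (hom_step : forall k, (K <= k)%N -> (1 - c0 * al k) * hom k <= hom k.+1).
Context (N_step : forall k, (K <= k)%N ->
  (1 - c0 * al k) * N k + al k ^+ 2 <= N k.+1).
Context (al_sum : \sum_(0 <= l < K) al l <= s).
Context (beta_ge : (1 + 4 * G * al 0%N) *
  (V 0%N + 2 * al 0%N * G * (1 + V 0%N) + 2 * H * (al 0%N * s)) <= beta).

Let al_le0 k : al k <= al 0%N.
Proof.
elim: k => // k IH; apply: le_trans IH.
by have /andP[h _] := al_decr k; rewrite -subr_ge0.
Qed.

Let U_ge0 k : 0 <= U k.
Proof. by rewrite le_max lexx orbT. Qed.

Let coef_ge0 k : 0 <= 1 - c0 * al k.
Proof.
have /andP[a0 _] := al01 k; have := mulr_gt0 c0_gt0 a0; have := hc k; lra.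
Qed.

(** Contraction is ignored and al_l^2 <= al_0 al_l. At m = K the sum is at most s, so the transient
    is O(al_0). *)
Let U_start m : U m <= U 0%N + 2 * H * (al 0%N * \sum_(0 <= l < m) al l).
Proof.
elim: m => [|m IH]; first by rewrite big_geq// mulr0 mulr0 addr0.
have /andP[a0 _] := al01 m; have H0 := lyap_const_ge0.
rewrite (le_trans (lyap_contraction (hG m) (hc m) (hH m)))// big_nat_recr//=.
have h1 : 0 <= c0 * al m * U m by rewrite !mulr_ge0// ltW.
have h2 : 2 * H * al m ^+ 2 <= 2 * H * (al 0%N * al m).
  by rewrite ler_wpM2l ?mulr_ge0// expr2 ler_wpM2r ?(ltW a0).
lra.
Qed.

Let comparison j : [/\ 0 <= hom (K + j)%N, 0 <= N (K + j)%N &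
  U (K + j)%N <= U K * hom (K + j)%N + 2 * H * N (K + j)%N].
Proof.
have H0 := lyap_const_ge0.
elim: j => [|j [h1 h2 h3]]; rewrite ?addn0 ?addnS.
  split=> //; first exact: le_trans hom1.
  by rewrite ler_wpDr ?mulr_ge0// ler_peMr.
have Kj : (K <= K + j)%N by rewrite leq_addr.
have hs := hom_step Kj; have ns := N_step Kj.
set k := (K + j)%N in h1 h2 h3 hs ns *; have c := coef_ge0 k.
split; first exact: le_trans (mulr_ge0 c h1) hs.
  exact: le_trans (addr_ge0 (mulr_ge0 c h2) (sqr_ge0 _)) ns.
have := lyap_contraction (hG k) (hc k) (hH k).
have := ler_wpM2l c h3; have := ler_wpM2l (U_ge0 K) hs.
have := ler_wpM2l (mulr_ge0 (ler0n R 2) H0) ns.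
lra.
Qed.

(** Returning from W to V costs 4 G al_k (1 + U_k): the factor 1 + 4 G al_k is part of [beta] and at
    most doubles 2H, and the additive part is the [al k] beside [N k]. *)
Lemma lyapunov_comparison k : (K <= k)%N ->
  V k <= beta * hom k + (4 * H + 4 * G) * (N k + al k).
Proof.
move=> Kk; have [] := comparison (k - K); rewrite subnKC// => h1 h2 h3.
have H0 := lyap_const_ge0; have /andP[a0 _] := al01 k; have /andP[a00 _] := al01 0.
have hW : W k <= U k by rewrite le_max lexx.
have g0 : 0 <= 4 * G * al k by rewrite !mulr_ge0// ltW.
have hV : V k <= (1 + 4 * G * al k) * U k + 4 * G * al k.
  have hg : - (2 * al k * g k) <= 2 * al k * (G * (1 + V k)).
    rewrite -mulrN ler_wpM2l ?mulr_ge0 ?(ltW a0)//.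
    by rewrite (le_trans (ler_norm _))// normrN g_bound.
  have h4 := ler_wpM2l (mulr_ge0 (mulr_ge0 (ler0n R 2) (ltW a0)) G_ge0) (V_le_lyap (hG k)).
  have h5 := ler_wpM2l g0 hW.
  by move: hg h4 h5 hW; rewrite /W; lra.
have hUK : (1 + 4 * G * al k) * U K <= beta.
  apply: le_trans beta_ge; rewrite ler_pM ?addr_ge0//.
    by rewrite lerD2l ler_wpM2l ?mulr_ge0.
  rewrite (le_trans (U_start K))// lerD//.
    rewrite ge_max; apply/andP; split; last first.
      by rewrite addr_ge0// !mulr_ge0 ?addr_ge0// ltW.
    rewrite /W lerD2l -mulrA -[leRHS]mulrA -[leRHS]mulrA ler_wpM2l// ler_wpM2l ?(ltW a00)//.
    exact: le_trans (ler_norm _) (g_bound _).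
  by rewrite ler_wpM2l ?mulr_ge0// ler_wpM2l ?(ltW a00).
have q1 := ler_wpM2r h1 hUK.
have q2 := ler_wpM2l (addr_ge0 (ler01 : 0 <= 1 :> R) g0) h3.
have q3 : (4 * G * al k) * (2 * H * N k) <= 1 * (2 * H * N k).
  by rewrite ler_wpM2r ?mulr_ge0.
have q4 : 0 <= 4 * H * al k by rewrite !mulr_ge0// ltW.
have q5 : 0 <= 4 * G * N k by rewrite !mulr_ge0.
lra.
Qed.

End comparison.

End lyapunov.

(** * Minima of sets of naturals *)

Section nat_min.

Lemma nat_minP (A : set nat) :
  (A (nat_min A) /\ forall j, A j -> (nat_min A <= j)%N) \/
  (nat_min A = 0%N /\ forall j, ~ A j).
Proof.
have [[k Ak]|nA] := pselect (exists k, A k); last first.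
  right; split=> [|j Aj]; last by apply: nA; exists j.
  by apply: xgetPN => k [Ak _]; apply: nA; exists k.
left; rewrite /nat_min; case: xgetP => [m _ //|/= h].
have ex : exists k, `[< A k >] by exists k; exact/asboolP.
case: (h (ex_minn ex)); case: ex_minnP => m /asboolP Am hm; split=> // j Aj.
by apply: hm; exact/asboolP.
Qed.

Lemma nat_min_le (A : set nat) k : A k -> (nat_min A <= k)%N.
Proof. by move=> Ak; have [[_ ->]//|[_ /(_ k)]] := nat_minP A. Qed.

Lemma nat_min_mem (A : set nat) k : A k -> A (nat_min A).
Proof. by move=> Ak; have [[]//|[_ /(_ k)]] := nat_minP A. Qed.

End nat_min.

(** * Elementary inequalities for powers and logarithms *)

Section real_powers.
Context {R : realType}.
Implicit Types (x p q : R).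

Lemma powR_large (r Y : R) : 0 < r ->
  exists2 x0 : R, 1 <= x0 & forall x, x0 <= x -> Y <= x `^ r.
Proof.
move=> r0; exists (1 + Num.max 1 Y `^ r^-1); first by rewrite lerDl powR_ge0.
move=> x hx; have m0 : 0 <= Num.max 1 Y by rewrite le_max ler01.
have hx' : Num.max 1 Y `^ r^-1 <= x by rewrite (le_trans _ hx)// lerDr.
apply: (@le_trans _ _ (Num.max 1 Y)); first by rewrite le_max lexx orbT.
rewrite -[leLHS]powRr1// -[X in _ `^ X <= _](mulVf (lt0r_neq0 r0)) powRrM.
apply: (ge0_ler_powR (ltW r0)); rewrite ?nnegrE ?powR_ge0//.
exact: le_trans (powR_ge0 _ _) hx'.
Qed.

Lemma ln_large (Y : R) : exists2 x0 : R, 1 <= x0 & forall x, x0 <= x -> Y <= ln x.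
Proof.
exists (1 + expR Y) => [|x hx]; first by rewrite lerDl expR_ge0.
rewrite -[Y]expRK ler_ln ?posrE ?expR_gt0//.
  by rewrite (le_trans _ hx)// lerDr.
by rewrite (lt_le_trans _ hx)// ltr_wpDr ?expR_ge0.
Qed.

(** After division by x^(-p), this is exp(-p ln(1 + 1/x)) >= 1 - p ln(1 + 1/x) >= 1 - p/x. *)
Lemma powR_inv_step x p : 0 < x -> 0 <= p ->
  (1 - p / x) * x `^ (- p) <= (x + 1) `^ (- p).
Proof.
move=> x0 p0; have y0 : 0 < 1 + x^-1 by rewrite addr_gt0// invr_gt0.
have -> : x + 1 = x * (1 + x^-1) by rewrite mulrDr mulr1 divff ?gt_eqF.
rewrite powRM ?(ltW x0) ?(ltW y0)// mulrC ler_wpM2l ?powR_ge0//.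
rewrite /powR gt_eqF// (le_trans _ (expR_ge1Dx _))// lerD2l mulNr lerN2.
by rewrite ler_wpM2l// le_ln1Dx// (lt_trans _ (_ : 0 < _))// ?invr_gt0// ltrN10.
Qed.

(** Young's inequality with exponents 1/q and 1/(1-q) gives (1 + 1/x)^q <= 1 + q/x. *)
Lemma powR_concave_step x q : 0 < x -> 0 < q < 1 ->
  (x + 1) `^ q - x `^ q <= q * x `^ (q - 1).
Proof.
move=> x0 /andP[q0 q1]; have y0 : 0 < 1 + x^-1 by rewrite addr_gt0// invr_gt0.
have -> : x + 1 = x * (1 + x^-1) by rewrite mulrDr mulr1 divff ?gt_eqF.
rewrite powRM ?(ltW x0) ?(ltW y0)//.
have q1' : 0 < 1 - q by rewrite subr_gt0.
have := @conjugate_powR _ ((1 + x^-1) `^ q) 1 q^-1 (1 - q)^-1 (powR_ge0 _ _) ler01.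
rewrite !invr_gt0 !invrK => /(_ q0 q1'); rewrite addrC subrK => /(_ erefl).
rewrite mulr1 powR1 -powRrM divff ?gt_eqF// powRr1 ?(ltW y0)// => h.
have xq := powR_ge0 x q; have := ler_wpM2l xq h.
have -> : x `^ (q - 1) = x `^ q * x^-1.
  by rewrite powRB ?powRr1 ?(ltW x0)// (gt_eqF x0) implybT.
lra.
Qed.

Lemma ln_step x : 0 < x -> ln x + (x + 1)^-1 <= ln (x + 1).
Proof.
move=> x0; have x1 : 0 < x + 1 by rewrite addr_gt0.
have h : -1 < - (x + 1)^-1 by rewrite ltrN2 invf_lt1// ltrDr.
have := le_ln1Dx h.
have -> : 1 - (x + 1)^-1 = x / (x + 1) by field; rewrite gt_eqF.
rewrite lnM ?posrE ?invr_gt0// lnV ?posrE//; lra.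
Qed.

(** rho^(-n) >= exp(E)^3 >= E^3 with E = y lam/3. The cube leaves one power of y beyond the square,
    and this beats C/alpha. *)
Lemma geometric_vs_quadratic (C rho alpha : R) : 0 < C -> 0 < rho < 1 -> 0 < alpha ->
  exists2 Y : R, 1 <= Y & forall y (n : nat), Y <= y -> y <= n%:R ->
    C * rho ^+ n <= alpha / y ^+ 2.
Proof.
move=> C0 /andP[r0 r1] a0; pose lam := - ln rho.
have lam0 : 0 < lam by rewrite oppr_gt0 ln_lt0// r0.
have l3 : 0 < (lam / 3) ^+ 3 by rewrite exprn_gt0// divr_gt0.
exists (1 + C / (alpha * (lam / 3) ^+ 3)).
  by rewrite lerDl divr_ge0 ?ltW// mulr_gt0.
move=> y n hy yn.
have y1 : 1 <= y.
  by rewrite (le_trans _ hy)// lerDl divr_ge0 ?ltW// mulr_gt0.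
have y0 : 0 < y by rewrite (lt_le_trans _ y1).
rewrite ler_pdivlMr ?exprn_gt0//.
pose E := y * (lam / 3).
have E0 : 0 <= E by rewrite mulr_ge0 ?divr_ge0 ?ltW.
have hE : rho ^+ n * E ^+ 3 <= 1.
  rewrite mulrC -ler_pdivlMr ?exprn_gt0// mul1r.
  have -> : (rho ^+ n)^-1 = expR (n%:R * lam).
    by rewrite mulrN expRN expRM_natl lnK ?posrE.
  apply: (@le_trans _ _ (expR E ^+ 3)).
    by rewrite lerXn2r ?nnegrE ?expR_ge0// (le_trans _ (expR_ge1Dx _))// lerDr.
  rewrite -expRM_natl ler_expR (_ : 3%:R * E = y * lam); last by rewrite /E; field.
  by rewrite ler_wpM2r// ltW.
have hC : C * y ^+ 2 <= alpha * E ^+ 3.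
  have : C <= y * (alpha * (lam / 3) ^+ 3).
    rewrite -ler_pdivrMr ?mulr_gt0// (le_trans _ hy)// lerDr//.
  move/(ler_wpM2r (sqr_ge0 y)) => /le_trans; apply.
  by rewrite /E le_eqVlt; apply/orP; left; apply/eqP; ring.
have rn : 0 <= rho ^+ n by rewrite exprn_ge0// ltW.
have := ler_wpM2l rn hC.
have := ler_wpM2l (ltW a0) hE.
lra.
Qed.

End real_powers.

(** * Mixing times *)

Section mixing.
Context {R : realType} {dS : measure_display} {S : measurableType dS}.
Context (P : R.-pker S ~> S) (mu : probability S R) (C rho : R).
Context (herg : uniformly_ergodic P mu C rho).

Lemma mixing_time_le (delta : R) n : C * rho ^+ n <= delta ->
  (mixing_time P mu delta <= n)%N.
Proof.
move=> h; have [_ _ _ _ hk] := herg; apply: nat_min_le => /=.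
by rewrite (le_trans (hk n))// lee_fin.
Qed.

Lemma mixing_time_mem (delta : R) : 0 < delta ->
  (sup_tv P mu (mixing_time P mu delta) <= delta%:E)%E.
Proof.
have [C1 r01 _ _ hk] := herg; move=> d0.
have C0 : 0 < C by rewrite (lt_le_trans _ C1).
have [Y Y1 hY] := geometric_vs_quadratic C0 r01 d0.
pose n := (Num.truncn Y).+1.
apply: (@nat_min_mem [set k | (sup_tv P mu k <= delta%:E)%E] n) => /=.
rewrite (le_trans (hk n))// lee_fin (le_trans (hY Y n _ _))//.
  by rewrite ltW// Num.Theory.truncnS_gt.
have Y0 : 0 < Y by rewrite (lt_le_trans _ Y1).
by rewrite ler_pdivrMr ?exprn_gt0// ler_peMr ?(ltW d0)// exprn_ege1.
Qed.

Lemma mixing_time_anti (d1 d2 : R) : 0 < d1 -> d1 <= d2 ->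
  (mixing_time P mu d2 <= mixing_time P mu d1)%N.
Proof.
move=> d0 d12; apply: nat_min_le => /=.
by rewrite (le_trans (mixing_time_mem d0))// lee_fin.
Qed.

(** Minimality of K > 0 gives K - 1 < t_(K-1) <= t_K <= K, so t_K = K and the window of the stepsize
    condition at K is all of [0, K). *)
Lemma start_sum (c0 L : R) (al : nat -> R) : 0 < c0 -> (forall k, 0 < al k) ->
  stepsize_condition P mu c0 L al ->
  \sum_(0 <= l < nat_min [set k | (mixing_time P mu (al k) <= k)%N]) al l
    <= c0 / (130 * L ^+ 2).
Proof.
move=> c00 al0 [al_anti _ hs].
have e0 : 0 <= c0 / (130 * L ^+ 2) by rewrite divr_ge0 ?(ltW c00)// mulr_ge0// sqr_ge0.
(* For an empty set the default K = 0 leaves an empty sum. *)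
have [[]|[-> _]] := nat_minP [set k | (mixing_time P mu (al k) <= k)%N]; last first.
  by rewrite big_geq.
move: (nat_min _) => [|K] /= hK Kmin; first by rewrite big_geq.
have : (K < mixing_time P mu (al K))%N.
  by rewrite ltnNge; apply/negP => /Kmin; rewrite ltnn.
move=> h1; have h2 := mixing_time_anti (al0 K.+1) (al_anti _ _ (leqnSn K)).
have e : mixing_time P mu (al K.+1) = K.+1.
  by apply/eqP; rewrite eqn_leq hK (leq_trans h1).
by have := hs K.+1 hK; rewrite e subnn => /ltW.
Qed.

End mixing.

(** * Polynomial stepsizes *)

Section polynomial_stepsizes.
Context {R : realType}.
Context (alpha xi : R) (alpha_gt0 : 0 < alpha) (xi_gt0 : 0 < xi) (xi_le1 : xi <= 1).

Let powxi_gt0 (x : R) : 0 < x -> 0 < x `^ xi. Proof. exact: powR_gt0. Qed.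

Lemma stepsizeE h k : stepsize alpha xi h k = alpha * (k%:R + h) `^ (- xi).
Proof. by rewrite powRN. Qed.

Lemma stepsize_gt0 h k : 0 < h -> 0 < stepsize alpha xi h k.
Proof. by move=> h0; rewrite divr_gt0// powR_gt0// ltr_wpDl. Qed.

Lemma stepsize_anti (h x y : R) : 0 < x -> x <= y ->
  alpha / y `^ xi <= alpha / x `^ xi.
Proof.
move=> x0 xy; rewrite ler_wpM2l ?(ltW alpha_gt0)//.
have y0 : 0 < y by rewrite (lt_le_trans x0).
rewrite lef_pV2 ?posrE ?powR_gt0//.
by apply: (ge0_ler_powR (ltW xi_gt0)); rewrite ?nnegrE// ltW.
Qed.

Lemma stepsize_nonincreasing h : 0 < h -> nonincreasing_seq (stepsize alpha xi h).
Proof.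
move=> h0 m n mn; apply: stepsize_anti => //; first by rewrite ltr_wpDl.
by rewrite lerD2r ler_nat.
Qed.

(** The relative decrease is at most xi/x, and xi/x <= x^(-xi) since xi <= 1 <= x. This provides the
    constant A = 1/alpha of the Lyapunov recursion, free of h. *)
Lemma stepsize_decr h k : 1 <= h ->
  0 <= stepsize alpha xi h k - stepsize alpha xi h k.+1 <=
    alpha^-1 * stepsize alpha xi h k ^+ 2.
Proof.
move=> h1; have h0 : 0 < h by rewrite (lt_le_trans _ h1).
rewrite subr_ge0 (stepsize_nonincreasing h0 (leqnSn k)) /=.
set x := k%:R + h; have x1 : 1 <= x by rewrite /x (le_trans h1)// lerDr.
have x0 : 0 < x by rewrite (lt_le_trans _ x1).
rewrite !stepsizeE -natr1 addrAC -/x.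
have px := powR_gt0 (- xi) x0.
have hs := ler_wpM2l (ltW alpha_gt0) (powR_inv_step x0 (ltW xi_gt0)).
have hx : xi / x <= x `^ (- xi).
  apply: (@le_trans _ _ (x^-1)).
    by rewrite -[leRHS]mul1r ler_wpM2r// invr_ge0 ltW.
  rewrite powRN lef_pV2 ?posrE ?powxi_gt0//.
  by rewrite -[leRHS]powRr1 ?(ltW x0)// ler_powR.
have := ler_wpM2l (ltW alpha_gt0) (ler_wpM2r (ltW px) hx).
have -> : alpha^-1 * (alpha * x `^ (- xi)) ^+ 2 = alpha * (x `^ (- xi) * x `^ (- xi)).
  by field; rewrite gt_eqF.
lra.
Qed.

Context {dS : measure_display} {S : measurableType dS}.
Context (P : R.-pker S ~> S) (mu : probability S R) (C rho : R).
Context (herg : uniformly_ergodic P mu C rho).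

Lemma half_powR (x : R) : 0 < x -> x `^ xi <= 2 * (x / 2) `^ xi.
Proof.
move=> x0; rewrite {1}(_ : x = 2 * (x / 2)); last by rewrite mulrC divfK// pnatr_eq0.
rewrite powRM ?divr_ge0 ?(ltW x0)// ler_wpM2r ?powR_ge0//.
by rewrite -[leRHS]powRr1// ler_powR// ler1n.
Qed.

(* The mixing time grows logarithmically, so it is at most 2 (k + h)^(xi / 2)
   as soon as h is large. *)
Lemma stepsize_condition_large (c0 L : R) : 0 < c0 -> 0 < L ->
  exists2 h0 : R, 1 <= h0 & forall h, h0 <= h ->
    stepsize_condition P mu c0 L (stepsize alpha xi h).
Proof.
move=> c00 L0; have [C1 r01 _ _ _] := herg.
have C0 : 0 < C by rewrite (lt_le_trans _ C1).
have [Y Y1 hY] := geometric_vs_quadratic C0 r01 alpha_gt0.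
pose eps := c0 / (130 * L ^+ 2).
have eps0 : 0 < eps by rewrite divr_gt0// mulr_gt0// exprn_gt0.
have xi2 : 0 < xi / 2 by rewrite divr_gt0.
have [h1 h11 hh1] := powR_large (Y + (4 * alpha / eps + 1)) xi2.
have [h2 h21 hh2] := powR_large (alpha + 1) xi_gt0.
exists (16 + h1 + h2); first lra.
move=> h hh; have h0 : 0 < h by lra.
split; first exact: stepsize_nonincreasing.
  rewrite stepsize_gt0//= /stepsize add0r ltr_pdivrMr ?powR_gt0// mul1r.
  by have : alpha + 1 <= h `^ xi; [apply: hh2; lra | lra].
move=> k; set t := mixing_time _ _ _ => tk.
set x := k%:R + h; have kx : k%:R <= x - h by rewrite /x addrK.
have k0 : 0 <= k%:R :> R by [].
have x0 : 0 < x by rewrite /x ltr_wpDl.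
(* Then al_k = alpha / y^2, the form in which [geometric_vs_quadratic] bounds the mixing time. *)
pose y := x `^ (xi / 2).
have y2 : y ^+ 2 = x `^ xi.
  by rewrite -powR_mulrn ?powR_ge0// -powRrM mulrVK// unitfE pnatr_eq0.
have hy : Y + (4 * alpha / eps + 1) <= y by apply: hh1; rewrite /x; lra.
have q0 : 0 <= 4 * alpha / eps by rewrite divr_ge0 ?(ltW eps0)// mulr_ge0// ltW.
have y1 : 1 <= y by lra.
have y0 : 0 < y by lra.
pose n := (Num.truncn y).+1.
have tn : (t <= n)%N.
  apply: (mixing_time_le herg); rewrite /stepsize -/x -y2.
  by apply: hY; [lra | rewrite ltW// Num.Theory.truncnS_gt].
have ny : n%:R <= y + 1.
  by rewrite -natr1 lerD2r Num.Theory.truncn_le// ltW.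
have ty : t%:R <= 2 * y by rewrite (le_trans (_ : _ <= n%:R))// ?ler_nat//; lra.
(* From y^2 <= x and x >= 16. The window has at most 2y steps, so it stays above x/2, where
   stepsizes are at most doubled. *)
have yx : 4 * y <= x.
  have : y ^+ 2 <= x.
    by rewrite y2 -[leRHS]powRr1 ?(ltW x0)// ler_powR// /x; lra.
  move=> yyx; rewrite -(@ler_pXn2r _ 2%N)// ?nnegrE ?mulr_ge0 ?(ltW x0) ?(ltW y0)//.
  rewrite exprMn; apply: (@le_trans _ _ (4 ^+ 2 * x)); first by rewrite ler_wpM2l// exprn_ge0.
  by rewrite [x ^+ 2]expr2 ler_wpM2r ?(ltW x0)// /x; lra.
have hk l : (k - t <= l)%N -> stepsize alpha xi h l <= 2 * alpha / y ^+ 2.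
  move=> kl; have hx2 : x / 2 <= l%:R + h.
    have : (k - t)%:R <= l%:R :> R by rewrite ler_nat.
    by rewrite natrB// /x; move: yx ty; rewrite /x; lra.
  have x20 : 0 < x / 2 by rewrite divr_gt0.
  rewrite (le_trans (stepsize_anti h x20 hx2))//.
  rewrite ler_pdivrMr ?powR_gt0// mulrAC ler_pdivlMr ?exprn_gt0//.
  have := ler_wpM2l (ltW alpha_gt0) (half_powR x0); rewrite -y2; lra.
apply: (@le_lt_trans _ _ (\sum_(k - t <= l < k) 2 * alpha / y ^+ 2)).
  by rewrite !big_nat; apply: ler_sum => l /andP[kl _]; exact: hk.
(* At most 2y terms of size 2 alpha / y^2 add up to 4 alpha / y, which is below [eps] by the choice
   of [h1]. *)
rewrite big_const_nat iter_addr addr0 subKn// -(mulr_natr (2 * alpha / y ^+ 2)).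
apply: (@le_lt_trans _ _ (2 * alpha / y ^+ 2 * (2 * y))).
  by rewrite ler_wpM2l// divr_ge0 ?exprn_ge0 ?(ltW y0)// mulr_ge0// ltW.
have -> : 2 * alpha / y ^+ 2 * (2 * y) = 4 * alpha / y by field; rewrite gt_eqF.
rewrite -/eps ltr_pdivrMr// -ltr_pdivrMl//; lra.
Qed.

End polynomial_stepsizes.

(** * Supersolutions for the noise and the initial error *)

Section supersolutions.
Context {R : realType}.
Implicit Types (a p x : R).

(** x^(-p) satisfies the homogeneous inequality, and subtracting 1/x creates a surplus close to
    D(1-p)/x^2 = 2 a^2/x^2. Half pays for the forcing, half for replacing x by x + 1. *)
Lemma noise_rate_lt1 a p x : p < 1 -> 0 < a -> 0 <= p -> 2 / (1 - p) <= x ->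
  0 < x ->
  forall D, D = 2 * a ^+ 2 / (1 - p) ->
  (1 - p / x) * (D * (x `^ (- p) - x^-1)) + (a / x) ^+ 2 <=
    D * ((x + 1) `^ (- p) - (x + 1)^-1).
Proof.
move=> p1 a0 p0 hx x0 D DE; have q0 : 0 < 1 - p by rewrite subr_gt0.
have D0 : 0 <= D by rewrite DE divr_ge0 ?(ltW q0)// mulr_ge0// sqr_ge0.
have x1 : 0 < x + 1 by rewrite addr_gt0.
have := ler_wpM2l D0 (powR_inv_step x0 p0).
suff : D / (x + 1) <= (1 - p / x) * (D / x) - (a / x) ^+ 2 by lra.
have e : D * (1 - p) = 2 * a ^+ 2 by rewrite DE divfK// gt_eqF.
have hD : D <= a ^+ 2 * x.
  have -> : D = a ^+ 2 * (2 / (1 - p)) by rewrite DE; ring.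
  by rewrite ler_wpM2l ?sqr_ge0.
rewrite ler_pdivrMr// -subr_ge0.
have -> : ((1 - p / x) * (D / x) - (a / x) ^+ 2) * (x + 1) - D =
   (D * (1 - p) * x - D * p - a ^+ 2 * (x + 1)) / x ^+ 2.
  by field; rewrite gt_eqF.
rewrite divr_ge0 ?sqr_ge0// e.
have -> : D * p = D - 2 * a ^+ 2 by rewrite -e; ring.
have := sqr_ge0 a; lra.
Qed.

(** The increment of ln provides 4 a^2/(x+1)^2, which covers a^2/x^2 for x >= 1; hence the 4. *)
Lemma noise_rate_eq1 a x : 1 <= x ->
  (1 - x^-1) * (4 * a ^+ 2 * (ln x / x)) + (a / x) ^+ 2 <=
    4 * a ^+ 2 * (ln (x + 1) / (x + 1)).
Proof.
move=> hx; have x0 : 0 < x by rewrite (lt_le_trans _ hx).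
have x1 : 0 < x + 1 by rewrite addr_gt0.
have a0 := sqr_ge0 a; have lx := ln_ge0 hx.
have h : (4 * a ^+ 2 / (x + 1)) * (ln x + (x + 1)^-1) <= (4 * a ^+ 2 / (x + 1)) * ln (x + 1).
  by rewrite ler_wpM2l ?ln_step// divr_ge0 ?(ltW x1)// mulr_ge0.
rewrite [leRHS](_ : _ = (4 * a ^+ 2 / (x + 1)) * ln (x + 1)); last by ring.
apply: le_trans h; rewrite -subr_ge0.
have -> : 4 * a ^+ 2 / (x + 1) * (ln x + (x + 1)^-1) -
    ((1 - x^-1) * (4 * a ^+ 2 * (ln x / x)) + (a / x) ^+ 2) =
    (4 * a ^+ 2 * ln x * (x + 1) + a ^+ 2 * (3 * x ^+ 2 - 2 * x - 1)) / (x ^+ 2 * (x + 1) ^+ 2).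
  by field; rewrite !gt_eqF.
apply: divr_ge0; last by apply: mulr_ge0; exact: sqr_ge0.
apply: addr_ge0; first by rewrite mulr_ge0 ?(ltW x1)// mulr_ge0// mulr_ge0.
apply: mulr_ge0 => //.
have -> : 3 * x ^+ 2 - 2 * x - 1 = (3 * x + 1) * (x - 1) by ring.
by rewrite mulr_ge0//; lra.
Qed.

(** 1/x decays more slowly than the contraction; the excess D(p-1)/x^2 is exactly the forcing. *)
Lemma noise_rate_gt1 a p x : 1 < p -> 0 < x ->
  forall D, D = a ^+ 2 / (p - 1) ->
  (1 - p / x) * (D / x) + (a / x) ^+ 2 <= D / (x + 1).
Proof.
move=> p1 x0 D DE; have q0 : 0 < p - 1 by rewrite subr_gt0.
have D0 : 0 <= D by rewrite DE divr_ge0 ?(ltW q0)// sqr_ge0.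
have x1 : 0 < x + 1 by rewrite addr_gt0.
have e : a ^+ 2 = D * (p - 1) by rewrite DE divfK// gt_eqF.
rewrite exprMn e -subr_ge0.
have -> : D / (x + 1) - ((1 - p / x) * (D / x) + D * (p - 1) * x^-1 ^+ 2) =
   D / (x ^+ 2 * (x + 1)) by field; rewrite !gt_eqF.
by rewrite divr_ge0// mulr_ge0 ?(ltW x1)// sqr_ge0.
Qed.

(** With N = (2a/c) x^(-xi), the contraction removes twice the forcing. The spare half covers the
    decay of N itself when xi/x <= (c a/2) x^(-xi), which is the hypothesis. *)
Lemma noise_rate_poly (a c xi x : R) : 0 < a -> 0 < c -> 0 < xi -> 1 <= x ->
  2 * xi / (c * a) <= x `^ (1 - xi) ->
  (1 - c * (a * x `^ (- xi))) * (2 * a / c * x `^ (- xi)) + (a * x `^ (- xi)) ^+ 2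
    <= 2 * a / c * (x + 1) `^ (- xi).
Proof.
move=> a0 c0 xi0 hx hxi; have x0 : 0 < x by rewrite (lt_le_trans _ hx).
have D0 : 0 <= 2 * a / c by rewrite divr_ge0 ?(ltW c0)// mulr_ge0// ltW.
apply: le_trans (ler_wpM2l D0 (powR_inv_step x0 (ltW xi0))).
set z := x `^ (- xi).
have z0 : 0 < z by exact: powR_gt0.
have e : x `^ (1 - xi) = x * z.
  by rewrite powRD ?powRr1 ?(ltW x0)// (gt_eqF x0) implybT.
rewrite e ler_pdivrMr ?mulr_gt0// in hxi.
rewrite -subr_ge0.
have -> : 2 * a / c * ((1 - xi / x) * z) - ((1 - c * (a * z)) * (2 * a / c * z) + (a * z) ^+ 2)
  = a * z * (x * z * (c * a) - 2 * xi) / (c * x) by field; rewrite !gt_eqF.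
by rewrite divr_ge0 ?mulr_ge0 ?(ltW a0) ?(ltW z0) ?subr_ge0 ?(ltW c0) ?(ltW x0).
Qed.

(** 1 - z <= exp(-z), and by concavity x^(-xi) dominates the increment of x^(1-xi)/(1-xi). *)
Lemma decay_poly (c xi x : R) : 0 <= c -> 0 < xi < 1 -> 0 < x ->
  1 - c * x `^ (- xi) <=
    expR (- (c / (1 - xi)) * ((x + 1) `^ (1 - xi) - x `^ (1 - xi))).
Proof.
move=> c0 /andP[xi0 xi1] x0; have q0 : 0 < 1 - xi by rewrite subr_gt0.
apply: le_trans (expR_ge1Dx _); rewrite lerD2l mulNr lerN2.
have q01 : 0 < 1 - xi < 1 by rewrite q0/= ltrBlDl ltrDr.
have := powR_concave_step x0 q01; rewrite (_ : 1 - xi - 1 = - xi); last by ring.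
move/(ler_wpM2l (divr_ge0 c0 (ltW q0))) => /le_trans; apply.
by rewrite mulrA divfK// gt_eqF.
Qed.

End supersolutions.

(** * The mean square error for a general pair of supersolutions *)

Section mean_square_error.
Context {R : realType} {dS : measure_display} {S : measurableType dS} {d : nat}.
Context (P : R.-pker S ~> S) (mu : probability S R) (F : S -> 'rV[R]_d -> 'rV[R]_d).
Context {dO : measure_display} {Omega : measurableType dO}.
Context (Pr : probability Omega R) (X : nat -> Omega -> S).
Context (theta0 ts : 'rV[R]_d) (L1 L2 c0 C rho alpha xi : R).
Context (hF : lipschitz_operator F L1) (hdis : dissipative mu F ts c0).
Context (herg : uniformly_ergodic P mu C rho) (L2_gt0 : 0 < L2).
Context (alpha_gt0 : 0 < alpha) (xi01 : 0 < xi <= 1).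

Let beta1 : R := (enorm theta0 + enorm (theta0 - ts) + 1) ^+ 2.

Lemma mse_start : enorm (theta0 - ts) ^+ 2 + 1 <= beta1.
Proof.
have h1 := enorm_ge0 theta0; have h2 := enorm_ge0 (theta0 - ts).
rewrite /beta1 -subr_ge0; move: (enorm _) (enorm (theta0 - ts)) h1 h2 => a b a0 b0.
have -> : (a + b + 1) ^+ 2 - (b ^+ 2 + 1) = a ^+ 2 + 2 * a * b + 2 * a + 2 * b by ring.
by rewrite !addr_ge0 ?sqr_ge0 ?mulr_ge0.
Qed.

(** Q is fixed before h and the noise, which allows a logarithm to absorb it later; every rate
    reduces to a choice of [hom] and [N]. *)
Lemma mse_bound : exists h0 Q : R, [/\ 1 <= h0, 0 <= Q & forall h, h0 <= h ->
  let al := stepsize alpha xi h in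
  let K := nat_min [set k | (mixing_time P mu (al k) <= k)%N] in
  stepsize_condition P mu c0 (L1 + L2) al /\
  forall w, let theta := sa_iterates F al X w theta0 in
    let Fk := sa_filtration theta X w in
    markov_chain Pr P X Fk -> noise_condition Pr theta w Fk L2 ->
    forall hom N : nat -> R, 1 <= hom K -> 0 <= N K ->
    (forall k, (K <= k)%N -> (1 - c0 * al k) * hom k <= hom k.+1) ->
    (forall k, (K <= k)%N -> (1 - c0 * al k) * N k + al k ^+ 2 <= N k.+1) ->
    forall k, (K <= k)%N ->
    ('E_Pr[fun omega => (enorm (theta k omega - ts) ^+ 2)%R] <=
      (beta1 * hom k + Q * (N k + al k))%:E)%E].
Proof.
have /andP[xi_gt0 xi_le1] := xi01.
have [L10 _ _ _] := hF; have [c00 _ _ _] := hdis; have [C1 r01 _ _ _] := herg.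
have /andP[r0 r1] := r01; have L0 : 0 < L1 + L2 by exact: addr_gt0.
pose B := drift_const L1 L2 C ts; pose G := B / (1 - rho).
have B0 : 0 <= B by exact: drift_const_ge0 hF herg L2_gt0.
have G0 : 0 <= G by rewrite divr_ge0// subr_ge0 ltW.
have A0 : 0 <= alpha^-1 by rewrite invr_ge0 ltW.
pose H := lyap_const B G alpha^-1 c0.
have H0 : 0 <= H by exact: lyap_const_ge0.
pose v0 := enorm (theta0 - ts) ^+ 2.
have v00 : 0 <= v0 by rewrite sqr_ge0.
pose s := c0 / (130 * (L1 + L2) ^+ 2).
have s0 : 0 <= s by rewrite divr_ge0 ?(ltW c00)// mulr_ge0// sqr_ge0.
(* al_0 Z bounds the excess of U_K over |theta_0 - theta*|^2. *)
pose Z := 2 * G * (1 + v0) + 2 * H * s.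
have G20 := mulr_ge0 (ler0n R 2) G0; have G40 := mulr_ge0 (ler0n R 4) G0.
have H20 := mulr_ge0 (ler0n R 2) H0.
have Z0 : 0 <= Z := addr_ge0 (mulr_ge0 G20 (addr_ge0 ler01 v00)) (mulr_ge0 H20 s0).
(* al_0 M <= 1 collects all smallness conditions: al <= 1, the three of [lyap_contraction], and,
   through the last bracket, a transient below the slack 1 of [beta1]. *)
pose M := 1 + 4 * G + 2 * c0 + 2 * H / c0 + (4 * G * v0 + 2 * Z).
have [h1 h11 hcond] := stepsize_condition_large alpha_gt0 xi_gt0 xi_le1 herg c00 L0.
have [h2 h21 hpow] := powR_large (alpha * M) xi_gt0.
exists (h1 + h2), (4 * H + 4 * G); split; [lra | exact: addr_ge0 (mulr_ge0 (ler0n R 4) H0) G40|].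
move=> h hh al K; have hcd : stepsize_condition P mu c0 (L1 + L2) al by apply: hcond; lra.
split=> // w theta Fk hmk hn hom N hom1 N0 homS NS k Kk.
have h_ge1 : 1 <= h by lra.
have h_gt0 : 0 < h by lra.
have al_gt0 j : 0 < al j by exact: stepsize_gt0.
have al_le j : al j <= al 0%N by exact: (stepsize_nonincreasing alpha_gt0 xi_gt0 h_gt0).
have q1 : al 0%N * M <= 1.
  rewrite /al /stepsize add0r mulrAC ler_pdivrMr ?powR_gt0// mul1r; apply: hpow; lra.
have q0 := al_gt0 0%N.
have p1 : 0 <= al 0%N * (4 * G) := mulr_ge0 (ltW q0) G40.
have p2 : 0 <= al 0%N * (2 * c0) := mulr_ge0 (ltW q0) (mulr_ge0 (ler0n R 2) (ltW c00)).
have p3 : 0 <= al 0%N * (2 * H / c0) := mulr_ge0 (ltW q0) (divr_ge0 H20 (ltW c00)).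
have p4 : 0 <= al 0%N * (4 * G * v0) := mulr_ge0 (ltW q0) (mulr_ge0 G40 v00).
have p5 : 0 <= al 0%N * (2 * Z) := mulr_ge0 (ltW q0) (mulr_ge0 (ler0n R 2) Z0).
have qM : al 0%N + al 0%N * (4 * G) + al 0%N * (2 * c0) + al 0%N * (2 * H / c0) +
    (al 0%N * (4 * G * v0) + al 0%N * (2 * Z)) <= 1 by move: q1; rewrite /M; lra.
have al01 j : 0 < al j <= 1 by rewrite al_gt0/=; have := al_le j; lra.
have [_ _ hw'] := hn.
have [D [mD D0 hw]] : exists D, [/\ measurable D, Pr (~` D) = 0%E &
    forall j x, D x -> enorm (w j x) <= L2 * (enorm (theta j x) + 1)].
  have [N' [mN PN sN]] := ae_foralln hw'.
  exists (~` N'); split; [exact: measurableC|by rewrite setCK|].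
  move=> j x Nx; apply: contrapT => nh; apply: Nx; apply: sN => /=.
  by move/(_ j).
have PrD : Pr D = 1%E := PrD1 mD D0.
pose V j := \int[Pr]_(x in D) enorm (theta j x - ts) ^+ 2.
pose b j n := \int[Pr]_(x in D) bias P mu F ts n (X j x) (theta j x).
have V0 j : 0 <= V j by apply: Rintegral_ge0 => x _; rewrite sqr_ge0.
have VE : V 0%N = v0.
  by rewrite /V /theta /= Rintegral_cst// -[RHS]mulr1; congr (_ * _); exact: (congr1 fine PrD).
have hb := mean_bias_bound ts hF herg L2_gt0 al01 hmk hn mD D0 hw.
have hs := mean_bias_shift ts hF herg L2_gt0 al01 hmk hn mD D0 hw.
have hd := mean_drift hF herg hdis L2_gt0 al01 hmk hn mD D0 hw.
have [g [g1 g2]] := poisson_solution V0 B0 r01 (fun j => ltW (al_gt0 j)) hb hs.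
have hb0 j : b j 0%N <= B * (1 + V j).
  by rewrite (le_trans (ler_norm _))// (le_trans (hb j 0%N))// expr0 mulr1.
rewrite (mean_sqdistE ts hF L2_gt0 al01 hmk hn mD D0 hw) lee_fin.
apply: (@lyapunov_comparison _ V al g (b ^~ 0%N) B G alpha^-1 c0 _ _ _ _ _ al01
  _ hb0 hd g1 g2 _ _ _ hom N K s) => //.
- by move=> j; exact: stepsize_decr.
- move=> j; have := ler_wpM2l (mulr_ge0 (ler0n R 4) G0) (al_le j); lra.
- move=> j; have := ler_wpM2l (mulr_ge0 (ler0n R 2) (ltW c00)) (al_le j); lra.
- move=> j; rewrite -/H.
  have : al 0%N * (2 * H / c0) <= 1 by lra.
  rewrite mulrA ler_pdivrMr// mul1r.
  have := ler_wpM2l (mulr_ge0 (ler0n R 2) H0) (al_le j); lra.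
- exact: (start_sum herg c00 al_gt0 hcd).
- rewrite -/H VE; apply: le_trans mse_start.
  have h4 : 0 <= al 0%N * Z := mulr_ge0 (ltW q0) Z0.
  have h5 : (al 0%N * (4 * G)) * (al 0%N * Z) <= 1 * (al 0%N * Z).
    by rewrite ler_wpM2r//; lra.
  rewrite -/v0; move: h5 qM; rewrite /Z; lra.
Qed.

End mean_square_error.

(** * Choice of h and the four rates *)

Lemma powR_div {R : realType} (a x p : R) : 0 <= a -> 0 < x ->
  (a / x) `^ p = a `^ p * x `^ (- p).
Proof.
move=> a0 x0; rewrite powRM ?invr_ge0 ?(ltW x0)//; congr (_ * _).
by rewrite -(powR_inv1 (ltW x0)) -powRrM mulN1r.
Qed.

(** l is the logarithmic factor and z the rate: once l exceeds QE/c, the prescribed constant c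
    replaces Q. *)
Lemma absorb {R : realType} (Q E c l z y Y : R) : 0 <= Q -> 0 <= z -> 0 < c ->
  y <= E * z -> `|Q * E / c| <= Y -> Y <= l -> Q * y <= c * (l * z).
Proof.
move=> Q0 z0 c0 yE hY Yl; apply: (le_trans (ler_wpM2l Q0 yE)).
rewrite !mulrA ler_wpM2r// -ler_pdivrMl// mulrC.
by rewrite (le_trans (ler_norm _))// (le_trans hY).
Qed.

Lemma le_add4 {R : realDomainType} (a b c d : R) :
  0 <= a -> 0 <= b -> 0 <= c -> 0 <= d ->
  [/\ a <= a + b + c + d, b <= a + b + c + d, c <= a + b + c + d
    & d <= a + b + c + d].
Proof. by move=> a0 b0 c0 d0; split; lra. Qed.

Lemma ln_threshold {R : realType} (Y a l : R) : 0 <= Y -> Y + `|a| + 1 <= l ->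
  Y <= l - a + 1 /\ 1 <= l.
Proof. by move=> Y0 h; have := ler_norm a; have := normr_ge0 a; split; lra. Qed.

Theorem corollary2p1p2 (R : realType) (nX d : nat)
  (XX : set 'rV[R]_nX) (x0 : XX)
  (P : R.-pker state_space x0 ~> state_space x0)
  (mu : probability (state_space x0) R)
  (F : state_space x0 -> 'rV[R]_d -> 'rV[R]_d)
  (dO : measure_display) (Omega : measurableType dO)
  (Pr : probability Omega R) (X : nat -> Omega -> state_space x0)
  (theta0 theta_star : 'rV[R]_d) (L1 L2 c0 C rho alpha xi : R) :
  lipschitz_operator F L1 ->
  dissipative mu F theta_star c0 ->
  uniformly_ergodic P mu C rho ->
  0 < L2 ->
  1 <= L1 + L2 ->
  0 < alpha ->
  0 < xi <= 1 ->
  let L := L1 + L2 in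
  let beta1 := (enorm theta0 + enorm (theta0 - theta_star) + 1) ^+ 2 in
  let beta2 := 130 * L ^+ 2 * (enorm theta_star + 1) ^+ 2 in
  let L3 := ln (C / rho) / ln (rho^-1) in
  exists2 hbar : R, 0 < hbar & forall h : R, hbar <= h ->
    let al := stepsize alpha xi h in
    let K := nat_min [set k | (mixing_time P mu (al k) <= k)%N] in
    stepsize_condition P mu c0 L al /\
    forall w : nat -> Omega -> 'rV[R]_d,
      let theta := sa_iterates F al X w theta0 in
      let Fk := sa_filtration theta X w in
      let mse k :=
        ('E_Pr[fun omega => (enorm (theta k omega - theta_star) ^+ 2)%R])%E in
      markov_chain Pr P X Fk ->
      noise_condition Pr theta w Fk L2 ->
      [/\ xi = 1 -> alpha < c0^-1 -> forall k, (K <= k)%N ->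
            (mse k <= (beta1 * ((K%:R + h) / (k%:R + h)) `^ (c0 * alpha)
              + 8 * beta2 * alpha ^+ 2 * L3 / (1 - c0 * alpha)
                * ((ln ((k%:R + h) / alpha) + 1)
                   / (k%:R + h) `^ (c0 * alpha)))%:E)%E,
          xi = 1 -> alpha = c0^-1 -> forall k, (K <= k)%N ->
            (mse k <= (beta1 * ((K%:R + h) / (k%:R + h))
              + 8 * beta2 * alpha ^+ 2 * L3
                * (ln (k%:R + h) * (ln ((k%:R + h) / alpha) + 1)
                   / (k%:R + h)))%:E)%E,
          xi = 1 -> c0^-1 < alpha -> forall k, (K <= k)%N ->
            (mse k <= (beta1 * ((K%:R + h) / (k%:R + h)) `^ (c0 * alpha)
              + 8 * expR 1 * beta2 * alpha ^+ 2 * L3 / (c0 * alpha - 1)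
                * ((ln ((k%:R + h) / alpha) + 1) / (k%:R + h)))%:E)%E
        & xi < 1 -> (2 * xi / (c0 * alpha)) `^ ((1 - xi)^-1) <= K%:R ->
          forall k, (K <= k)%N ->
            (mse k <= (beta1 * expR (- (c0 * alpha / (1 - xi))
                  * ((k%:R + h) `^ (1 - xi) - (K%:R + h) `^ (1 - xi)))
              + 4 * beta2 * alpha * L3 / c0
                * ((ln ((k%:R + h) / alpha) + 1)
                   / (k%:R + h) `^ xi))%:E)%E].
Proof.
move=> hF hdis herg L20 L1L alpha0 xi01 L beta1 beta2 L3.
have [L10 _ _ _] := hF; have [c00 _ _ _] := hdis; have [C1 r01 _ _ _] := herg.
have /andP[r0 r1] := r01; have /andP[xi0 xi1] := xi01.
have [h0 [Q [h01 Q0 hmse]]] := mse_bound Pr X theta0 hF hdis herg L20 alpha0 xi01.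
have L30 : 0 < L3.
  have ri : 1 < rho^-1 by rewrite invf_gt1.
  have Cr : 1 < C / rho by rewrite (lt_le_trans ri)// ler_peMl// invr_ge0 ltW.
  by rewrite divr_gt0// ln_gt0.
have b20 : 0 < beta2.
  apply: mulr_gt0; last by rewrite exprn_gt0// ltr_wpDl// enorm_ge0.
  by apply: mulr_gt0 => //; rewrite exprn_gt0// addr_gt0.
have a20 : 0 < alpha ^+ 2 by rewrite exprn_gt0.
have c8 : 0 < 8 * beta2 * alpha ^+ 2 * L3 :=
  mulr_gt0 (mulr_gt0 (mulr_gt0 (ltr0Sn R 7) b20) a20) L30.
pose p := c0 * alpha.
(* [Da], [Dc], [Dd] are the coefficients of the noise supersolutions, and [ca] to [cd] the
   prefactors of the four claimed bounds. *)
pose Da := 2 * alpha ^+ 2 / (1 - p).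
pose Dc := alpha ^+ 2 / (p - 1).
pose Dd := 2 * alpha / c0.
pose ca := 8 * beta2 * alpha ^+ 2 * L3 / (1 - p).
pose cb := 8 * beta2 * alpha ^+ 2 * L3.
pose cc := 8 * expR 1 * beta2 * alpha ^+ 2 * L3 / (p - 1).
pose cd := 4 * beta2 * alpha * L3 / c0.
(* One threshold for all regimes; absolute values are taken because 1 - p or p - 1 is negative or
   zero outside its own regime. *)
pose Y := `|Q * (Da + alpha) / ca| + `|Q * (4 * alpha ^+ 2 + alpha) / cb| +
  `|Q * (Dc + alpha) / cc| + `|Q * (Dd + alpha) / cd|.
have Y0 : 0 <= Y by rewrite !addr_ge0.
have [h1 h11 hln] := ln_large (Y + `|ln alpha| + 1).
have [h2 h21 hxi] : exists2 h2 : R, 1 <= h2 & xi < 1 ->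
    forall x, h2 <= x -> 2 * xi / (c0 * alpha) <= x `^ (1 - xi).
  have [xi_lt1|_] := ltP xi 1; last by exists 1.
  have q0 : 0 < 1 - xi by rewrite subr_gt0.
  by have [h2 h21 hh] := powR_large (2 * xi / (c0 * alpha)) q0; exists h2.
have [hh0 hh1 hh2 hh3] := le_add4 (le_trans ler01 h01) (le_trans ler01 h11)
  (le_trans ler01 h21) (normr_ge0 (2 / (1 - p))).
(* The last summand is the threshold of [noise_rate_lt1]. *)
exists (h0 + h1 + h2 + `|2 / (1 - p)|).
  exact: lt_le_trans ltr01 (le_trans h01 hh0).
move=> h hh al K.
have {}hh0 := le_trans hh0 hh; have {}hh1 := le_trans hh1 hh.
have {}hh2 := le_trans hh2 hh; have {}hh3 := le_trans hh3 hh.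
have [hcd hbound] := hmse h hh0; split=> // w theta Fk mse hmk hn.
have {}hbound : forall hom N : nat -> R, 1 <= hom K -> 0 <= N K ->
    (forall k, (K <= k)%N -> (1 - c0 * al k) * hom k <= hom k.+1) ->
    (forall k, (K <= k)%N -> (1 - c0 * al k) * N k + al k ^+ 2 <= N k.+1) ->
    forall k, (K <= k)%N -> (mse k <= (beta1 * hom k + Q * (N k + al k))%:E)%E.
  exact: hbound w hmk hn.
have h_ge1 : 1 <= h := le_trans h01 hh0.
have h_gt0 : 0 < h := lt_le_trans ltr01 h_ge1.
have xh k : h <= k%:R + h by rewrite lerDr.
have x_ge1 k : 1 <= k%:R + h by exact: le_trans (xh k).
have x_gt0 k : 0 < k%:R + h by exact: lt_le_trans (x_ge1 k).
have xS k : k.+1%:R + h = k%:R + h + 1 by rewrite -natr1 addrAC.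
have lnx k := ln_threshold Y0 (hln _ (le_trans hh1 (xh k))).
have lnxa k : Y <= ln ((k%:R + h) / alpha) + 1.
  by rewrite lnM ?posrE ?invr_gt0// lnV ?posrE//; have [] := lnx k.
have [Ya Yb Yc Yd] := le_add4 (normr_ge0 (Q * (Da + alpha) / ca))
  (normr_ge0 (Q * (4 * alpha ^+ 2 + alpha) / cb))
  (normr_ge0 (Q * (Dc + alpha) / cc)) (normr_ge0 (Q * (Dd + alpha) / cd)).
have al1 k : xi = 1 -> al k = alpha / (k%:R + h).
  by move=> xiE; rewrite /al /stepsize xiE powRr1// ltW.
have p0 : 0 < p by rewrite mulr_gt0.
have hom_powR k : xi = 1 -> (1 - c0 * al k) * ((K%:R + h) / (k%:R + h)) `^ p <=
    ((K%:R + h) / (k.+1%:R + h)) `^ p.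
  move=> xiE; rewrite al1// mulrA !powR_div ?(ltW (x_gt0 _))// xS.
  by rewrite mulrCA ler_wpM2l ?powR_ge0// powR_inv_step// ltW.
split.
- move=> xiE apc k Kk.
  have p1 : p < 1 by rewrite /p mulrC -ltr_pdivlMr// mul1r.
  have q0 : 0 < 1 - p by rewrite subr_gt0.
  have ca0 : 0 < ca by rewrite divr_gt0.
  have Da0 : 0 <= Da by rewrite divr_ge0 ?(ltW q0)// mulr_ge0// ltW.
  apply: le_trans (hbound (fun k => ((K%:R + h) / (k%:R + h)) `^ p)
    (fun k => Da * ((k%:R + h) `^ (- p) - (k%:R + h)^-1)) _ _ _ _ k Kk) _.
  + by rewrite divff ?powR1// gt_eqF.
  + rewrite mulr_ge0// subr_ge0 powRN lef_pV2 ?posrE ?powR_gt0//.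
    by rewrite -[leRHS]powRr1 ?(ltW (x_gt0 _))// ler_powR// ltW.
  + by move=> j _; exact: hom_powR.
  + move=> j _; rewrite al1// mulrA xS; apply: noise_rate_lt1 => //; first exact: ltW.
    exact: le_trans (ler_norm _) (le_trans hh3 (xh j)).
  rewrite lee_fin lerD2l -/p -/ca -powRN.
  (* Since p < 1 <= x, al_k = alpha/x is at most alpha x^(-p), so both terms share one rate. *)
  apply: (absorb Q0 (powR_ge0 _ _) ca0 _ Ya (lnxa k)).
  rewrite al1// mulrDl lerD//.
    by rewrite ler_wpM2l// lerBlDr lerDl invr_ge0 ltW.
  rewrite ler_wpM2l ?(ltW alpha0)// powRN lef_pV2 ?posrE ?powR_gt0//.
  by rewrite -[leRHS]powRr1 ?(ltW (x_gt0 _))// ler_powR// ltW.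
- move=> xiE apc k Kk.
  have c0al j : c0 * al j = (j%:R + h)^-1.
    by rewrite al1// apc mulrA divff ?mul1r// gt_eqF.
  apply: le_trans (hbound (fun k => (K%:R + h) / (k%:R + h))
    (fun k => 4 * alpha ^+ 2 * (ln (k%:R + h) / (k%:R + h))) _ _ _ _ k Kk) _.
  + by rewrite divff// gt_eqF.
  + apply: mulr_ge0; first exact: mulr_ge0 (ler0n R 4) (ltW a20).
    by rewrite divr_ge0 ?ln_ge0// ltW.
  + move=> j _; rewrite c0al xS.
    have xj0 := x_gt0 j; have xj1 : 0 < j%:R + h + 1 by rewrite addr_gt0.
    rewrite -subr_ge0 [leRHS](_ : _ = (K%:R + h) / ((j%:R + h) ^+ 2 * (j%:R + h + 1))).
      by rewrite divr_ge0 ?(ltW (x_gt0 _))// mulr_ge0 ?sqr_ge0// ltW.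
    by field; rewrite !gt_eqF.
  + by move=> j _; rewrite c0al al1// xS; exact: noise_rate_eq1.
  (* ln x >= 1 allows al_k = alpha/x to be absorbed into the rate ln x / x. *)
  have [_ lk1] := lnx k.
  rewrite lee_fin lerD2l -/cb.
  rewrite [X in _ <= cb * X](_ : _ = (ln ((k%:R + h) / alpha) + 1) *
    (ln (k%:R + h) / (k%:R + h))); last by ring.
  have z0 : 0 <= ln (k%:R + h) / (k%:R + h) :=
    divr_ge0 (le_trans ler01 lk1) (ltW (x_gt0 k)).
  apply: (absorb Q0 z0 c8 _ Yb (lnxa k)).
  rewrite al1// (mulrDl (4 * alpha ^+ 2)) lerD// ler_wpM2l ?(ltW alpha0)//.
  by rewrite ler_peMl// invr_ge0 ltW.
- move=> xiE apc k Kk.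
  have p1 : 1 < p by rewrite /p mulrC -ltr_pdivrMr// mul1r.
  have q0 : 0 < p - 1 by rewrite subr_gt0.
  have cc0 : 0 < cc.
    exact: (divr_gt0 (mulr_gt0 (mulr_gt0 (mulr_gt0 (mulr_gt0 (ltr0Sn R 7)
      (expR_gt0 1)) b20) a20) L30) q0).
  have Dc0 : 0 <= Dc by rewrite divr_ge0 ?(ltW q0)// ltW.
  apply: le_trans (hbound (fun k => ((K%:R + h) / (k%:R + h)) `^ p)
    (fun k => Dc / (k%:R + h)) _ _ _ _ k Kk) _.
  + by rewrite divff ?powR1// gt_eqF.
  + by rewrite divr_ge0// ltW.
  + by move=> j _; exact: hom_powR.
  + by move=> j _; rewrite al1// mulrA xS; apply: noise_rate_gt1.
  rewrite lee_fin lerD2l -/p -/cc.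
  have z0 : 0 <= (k%:R + h)^-1 by rewrite invr_ge0 ltW.
  apply: (absorb Q0 z0 cc0 _ Yc (lnxa k)).
  by rewrite al1// mulrDl.
- move=> xi_lt1 _ k Kk.
  have cd0 : 0 < cd :=
    divr_gt0 (mulr_gt0 (mulr_gt0 (mulr_gt0 (ltr0Sn R 3) b20) alpha0) L30) c00.
  have alE j : al j = alpha * (j%:R + h) `^ (- xi) by exact: stepsizeE.
  apply: le_trans (hbound (fun k => expR (- (c0 * alpha / (1 - xi))
                  * ((k%:R + h) `^ (1 - xi) - (K%:R + h) `^ (1 - xi))))
    (fun k => Dd * (k%:R + h) `^ (- xi)) _ _ _ _ k Kk) _.
  + by rewrite subrr mulr0 expR0.
  + by rewrite mulr_ge0 ?powR_ge0// divr_ge0 ?(ltW c00)// mulr_ge0// ltW.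
  + move=> j _; rewrite alE xS mulrA.
    have xi01' : 0 < xi < 1 by rewrite xi0.
    have := decay_poly (ltW p0) xi01' (x_gt0 j).
    set z := (j%:R + h) `^ (1 - xi); set z' := (_ + 1) `^ (1 - xi).
    set zK := (K%:R + h) `^ (1 - xi) => hd.
    rewrite (_ : - _ * (z' - zK) = - (c0 * alpha / (1 - xi)) * (z' - z) +
       - (c0 * alpha / (1 - xi)) * (z - zK)); last by ring.
    by rewrite expRD; exact: (ler_wpM2r (expR_ge0 _) hd).
  + move=> j _; rewrite alE xS; apply: noise_rate_poly => //.
    exact: hxi xi_lt1 _ (le_trans hh2 (xh j)).
  rewrite lee_fin lerD2l -/cd -powRN.
  apply: (absorb Q0 (powR_ge0 _ _) cd0 _ Yd (lnxa k)).
  by rewrite alE mulrDl.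
Qed.
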